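(* Let $(\Omega,\mathcal A)$ be a Borel space, $(\Omega,X_\bullet)$ a Borel field of proper unbounded CAT(0) spaces, and $A_\bullet$ a Borel subfield of $(\Omega,\partial X_\bullet)$ such that each $A_\omega$ is non-empty and closed in the cone topology. Then (i) the function $\omega\mapsto r(A_\omega)$, where $r$ is the circumradius with respect to the angular (Tits) metric, is Borel; and (ii) if moreover $r(A_\omega)<\pi/2$ for every $\omega$, then the section of circumcenters $\omega\mapsto c_{A_\omega}$ belongs to $\mathcal L(\Omega,\partial X_\bullet)$.
   Context: Borel field of metric spaces: $(X_\omega,d_\omega)_{\omega\in\Omega}$ metric spaces; a section is $x_\bullet=(x_\omega)$. A Borel structure is a set $\mathcal L(\Omega,X_\bullet)$ of sections such that (a) $\omega\mapsto d_\omega(x_\omega,y_\omega)$ is Borel for all $x_\bullet,y_\bullet\in\mathcal L$; (b) any section $y_\bullet$ with $\omega\mapsto d_\omega(x_\omega,y_\omega)$ Borel for all $x_\bullet\in\mathcal L$ lies in $\mathcal L$; (c) there is a countable $\{x^n_\bullet\}\subseteq\mathcal L$ with $\{x^n_\omega\}_n$ dense in $X_\omega$ for all $\omega$. A subfield $A_\bullet$ ($A_\omega\subseteq X_\omega$) is Borel if $\Omega'=\{A_\omega\ne\emptyset\}$ is Borel and there are countably many Borel sections over $\Omega'$ taking values in $A_\omega$ and dense in $A_\omega$. Boundary field: fix a Borel section $x^0_\bullet$; with $i_\omega(x)=d_\omega(x,\cdot)-d_\omega(x,x^0_\omega)$, $\partial X_\omega$ is identified with $\overline{i_\omega(X_\omega)}\setminus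 i_\omega(X_\omega)$ = the Busemann functions $b_{x^0_\omega,\xi}$ inside $\mathcal C(X_\omega)$ with the metric of uniform convergence on compacta $\delta_\omega(f,g)=\inf\{\varepsilon>0\mid\sup_{B(x^0_\omega,1/\varepsilon)}|f-g|<\varepsilon\}$; this makes $(\Omega,\partial X_\bullet)$ a Borel field of compact metric spaces (cone topology) whose Borel sections $\xi_\bullet$ are those with $\omega\mapsto b_{x^0_\omega,\xi_\omega}(x_\omega)$ Borel for all Borel $x_\bullet$. Angular metric: $\angle(\xi,\eta)=\sup_{x\in X}\angle_x(\xi,\eta)$, where $\angle_x(\xi,\eta)$ is the Alexandrov angle at $x$ between the rays from $x$ to $\xi$ and $\eta$. For non-empty $A\subseteq\partial X$: $r(A)=\inf_{\xi\in\partial X}\sup_{\eta\in A}\angle(\xi,\eta)$; when $r(A)<\pi/2$ there is a unique $c_A\in\partial X$ with $\sup_{\eta\in A}\angle(c_A,\eta)=r(A)$, the circumcenter. *)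

(* Defs.v *)
From Stdlib Require Import Reals Lra Classical ClassicalEpsilon.
Open Scope R_scope.
Set Implicit Arguments.

(* Supremum of a non-empty bounded-above set of reals; default 0 otherwise
   (all sets to which it is applied below are non-empty and bounded). *)
Definition Rsup (E : R -> Prop) : R :=
  match excluded_middle_informative (bound E /\ exists x, E x) with
  | left H => proj1_sig (completeness E (proj1 H) (proj2 H))
  | right _ => 0
  end.

Definition Rinf (E : R -> Prop) : R := - Rsup (fun x => E (- x)).

Record sigma_algebra (Om : Type) (M : (Om -> Prop) -> Prop) : Prop := {
  sa_full  : M (fun _ => True);
  sa_compl : forall S, M S -> M (fun w => ~ S w);
  sa_union : forall S : nat -> Om -> Prop,
               (forall n, M (S n)) -> M (fun w => exists n, S n w) }.

Definition R_open (U : R -> Prop) : Prop :=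
  forall x, U x -> exists e, 0 < e /\ forall y, Rabs (y - x) < e -> U y.

Inductive borelR : (R -> Prop) -> Prop :=
  | borelR_open  : forall U, R_open U -> borelR U
  | borelR_compl : forall B, borelR B -> borelR (fun x => ~ B x)
  | borelR_union : forall B : nat -> R -> Prop,
      (forall n, borelR (B n)) -> borelR (fun x => exists n, B n x).

Definition borel_fun (Om : Type) (M : (Om -> Prop) -> Prop) (f : Om -> R) : Prop :=
  forall B, borelR B -> M (fun w => B (f w)).

Definition borel_fun_on (Om : Type) (M : (Om -> Prop) -> Prop)
  (Om' : Om -> Prop) (f : Om -> R) : Prop :=
  forall B, borelR B -> M (fun w => Om' w /\ B (f w)).

Section Metric.
Variable T : Type.
Variable d : T -> T -> R.

Definition is_metric : Prop :=
  (forall x y, 0 <= d x y) /\ (forall x y, d x y = 0 <-> x = y) /\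
  (forall x y, d x y = d y x) /\ (forall x y z, d x z <= d x y + d y z).

Definition seq_converges (u : nat -> T) (l : T) : Prop :=
  forall e, 0 < e -> exists N, forall n, (N <= n)%nat -> d (u n) l < e.

(* proper: closed balls are compact (= sequentially compact, in a metric space) *)
Definition proper : Prop :=
  forall x r (u : nat -> T), (forall n, d x (u n) <= r) ->
    exists (phi : nat -> nat) l,
      (forall n, (phi n < phi (S n))%nat) /\ seq_converges (fun n => u (phi n)) l.

Definition unbounded : Prop := forall x r, exists y, r < d x y.

Definition geodesic (p q : T) (g : R -> T) : Prop :=
  g 0 = p /\ g (d p q) = q /\
  forall s t, 0 <= s <= d p q -> 0 <= t <= d p q -> d (g s) (g t) = Rabs (s - t).

(* CAT(0): geodesic, and every geodesic triangle satisfies the CAT(0)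
   comparison inequality.  Any two points of a triangle lie on two sides
   issuing from a common vertex p; for points at distances s, t from p on
   sides [p,q], [p,r] the Euclidean comparison distance squared is
   s^2 + t^2 - 2 s t cos(gamma), cos(gamma) = (a^2+b^2-c^2)/(2ab). *)
Definition CAT0 : Prop :=
  (forall p q, exists g, geodesic p q g) /\
  forall p q r g1 g2, geodesic p q g1 -> geodesic p r g2 ->
    0 < d p q -> 0 < d p r ->
    forall s t, 0 <= s <= d p q -> 0 <= t <= d p r ->
      (d (g1 s) (g2 t))² <=
        s² + t² - s * t * ((d p q)² + (d p r)² - (d q r)²) / (d p q * d p r).

Definition geod_ray (x : T) (c : R -> T) : Prop :=
  c 0 = x /\ forall s t, 0 <= s -> 0 <= t -> d (c s) (c t) = Rabs (s - t).

(* Comparison angle at x between p and q (law of cosines in R^2). *)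
Definition comparison_angle (x p q : T) : R :=
  acos (((d x p)² + (d x q)² - (d p q)²) / (2 * d x p * d x q)).

(* Alexandrov angle between two geodesic (rays) c, c' issuing from the same
   point: limsup_{t,t' -> 0} of the comparison angles. *)
Definition alexandrov_angle (c c' : R -> T) : R :=
  Rinf (fun a => exists e, 0 < e /\
     a = Rsup (fun b => exists t t', 0 < t < e /\ 0 < t' < e /\
                 b = comparison_angle (c 0) (c t) (c' t'))).

Variable x0 : T.

Definition iota (x : T) : T -> R := fun y => d x y - d x x0.

(* "delta(f,g) < e", where
   delta(f,g) = inf { e' > 0 | sup_{B(x0,1/e')} |f - g| < e' }. *)
Definition delta_lt (f g : T -> R) (e : R) : Prop :=
  exists e', 0 < e' < e /\ exists h, h < e' /\
    forall y, d x0 y < / e' -> Rabs (f y - g y) <= h.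

Definition bdry (f : T -> R) : Prop :=
  (forall e, 0 < e -> exists x, delta_lt (iota x) f e) /\
  ~ (exists x, forall y, f y = iota x y).

Definition cone_closed (A : (T -> R) -> Prop) : Prop :=
  forall f, bdry f -> (forall e, 0 < e -> exists g, A g /\ delta_lt g f e) -> A f.

(* c is a geodesic ray from x representing the boundary point f,
   i.e. iota(c(t)) -> f = b_{x0,xi} as t -> oo *)
Definition ray_to (x : T) (f : T -> R) (c : R -> T) : Prop :=
  geod_ray x c /\
  forall y e, 0 < e -> exists t0, forall t, t0 <= t ->
     Rabs (d y (c t) - d x0 (c t) - f y) < e.

Definition tits_angle (xi eta : T -> R) : R :=
  Rsup (fun a => exists x c c', ray_to x xi c /\ ray_to x eta c' /\
                               a = alexandrov_angle c c').

Definition circumradius (A : (T -> R) -> Prop) : R :=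
  Rinf (fun a => exists xi, bdry xi /\
           a = Rsup (fun b => exists eta, A eta /\ b = tits_angle xi eta)).

Definition is_circumcenter (A : (T -> R) -> Prop) (c : T -> R) : Prop :=
  bdry c /\ Rsup (fun b => exists eta, A eta /\ b = tits_angle c eta) = circumradius A.

End Metric.

Section Fields.
Variable Om : Type.
Variable M : (Om -> Prop) -> Prop.
Variable X : Om -> Type.
Variable d : forall w, X w -> X w -> R.

Definition section := forall w, X w.

Definition borel_structure (L : section -> Prop) : Prop :=
  (forall x y, L x -> L y -> borel_fun M (fun w => d (x w) (y w))) /\
  (forall y : section, (forall x, L x -> borel_fun M (fun w => d (x w) (y w))) -> L y) /\
  (exists xs : nat -> section, (forall n, L (xs n)) /\
     forall w (x : X w) e, 0 < e -> exists n, d (xs n w) x < e).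

Definition borel_field (L : section -> Prop) : Prop :=
  (forall w, is_metric (@d w)) /\ borel_structure L.

(* Boundary field, base point section x0: a boundary section is
   xi : forall w, X w -> R with xi w in dX_w; it is Borel iff
   w |-> b_{x0,xi_w}(x_w) = xi w (x w) is Borel for every Borel x. *)
Definition borel_bdry_section (L : section -> Prop) (x0 : section)
  (xi : forall w, X w -> R) : Prop :=
  (forall w, bdry (@d w) (x0 w) (xi w)) /\
  forall x, L x -> borel_fun M (fun w => xi w (x w)).

(* Borel subfield A of the boundary field.  Sections over Om' are modelled
   as total sections whose values outside Om' are irrelevant. *)
Definition borel_bdry_subfield (L : section -> Prop) (x0 : section)
  (A : forall w, (X w -> R) -> Prop) : Prop :=
  (forall w f, A w f -> bdry (@d w) (x0 w) f) /\
  let Om' := fun w => exists f, A w f in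
  M Om' /\
  exists a : nat -> forall w, X w -> R,
    (forall n w, Om' w -> bdry (@d w) (x0 w) (a n w) /\ A w (a n w)) /\
    (forall n x, L x -> borel_fun_on M Om' (fun w => a n w (x w))) /\
    (forall w f e, A w f -> 0 < e -> exists n, delta_lt (@d w) (x0 w) (a n w) f e).

End Fields.

(* Main.v *)
Require Import Defs.
From Stdlib Require Import Reals Lra Lia Classical ClassicalEpsilon.
From Stdlib Require Import FunctionalExtensionality PropExtensionality.
Open Scope R_scope.
Set Implicit Arguments.

(** Let [c] be the ray from [x0] to [xi].  The Busemann function [eta] is convex
    along [c], its one-sided derivative at [c u] is minus the cosine of the
    Alexandrov angle there (first variation), and asymptotic rays have the same
    slope at infinity.  Hence [- cos (tits_angle xi eta) = sup_t eta (c t) / t],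
    and [circumradius A <= a] iff some ray from [x0] satisfies
    [eta (c t) <= - t cos a] for all [eta] in [A] and all [t].  By properness such
    a ray exists iff for every [n] some point [y] with [d x0 y >= n] satisfies
    [eta y <= - cos a * d x0 y + 2] for all [eta] in [A]; here [y] and [eta] can be
    restricted to countable dense families, so the condition is Borel.
    If [circumradius A < PI / 2], midpoints of two optimal rays would descend
    faster than the optimum, so the optimal ray is unique, and every sequence of
    such points [y] (for [a] the circumradius) converges to the circumcenter. *)

(** * Elementary inequalities, real sequences and diagonal extraction *)

Lemma le_of_le_add_eps a b : (forall e, 0 < e -> a <= b + e) -> a <= b.
Proof.
  intros H. destruct (Rle_dec a b) as [h|h]; auto.
  specialize (H ((a - b) / 2)). lra.
Qed.

Lemma Rsqr_le_inv_nonneg a b : a² <= b² -> 0 <= b -> a <= b.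
Proof.
  intros H Hb. destruct (Rle_dec 0 a).
  - apply Rsqr_incr_0_var; auto.
  - lra.
Qed.

(** Tangent-line bound for the square root at [q²]. The error [rho² / (2 * q)] vanishes as [q]
    grows, which drives the convergence of distances along rays. *)
Lemma sqrt_bound D q rho : 0 < q -> D² <= q² + rho² -> D <= q + rho² / (2 * q).
Proof.
  intros Hq H. assert (0 <= rho²) by apply Rle_0_sqr.
  assert (0 <= rho² / (2 * q)) by (apply Rmult_le_pos; auto; left; apply Rinv_0_lt_compat; lra).
  apply Rsqr_le_inv_nonneg; [|lra].
  eapply Rle_trans; [exact H|].
  assert (E : (q + rho² / (2 * q))² = q² + rho² + (rho² / (2 * q))²).
  { unfold Rsqr. field. lra. }
  rewrite E. pose proof (Rle_0_sqr (rho² / (2 * q))). lra.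
Qed.

Lemma eps_inv_gt r e : 0 < e -> exists e', 0 < e' < e /\ r < / e'.
Proof.
  intros He. exists (/ (Rabs r + 1 + / e)).
  assert (0 < / e) by (apply Rinv_0_lt_compat; auto).
  pose proof (Rabs_pos r). pose proof (Rle_abs r).
  split; [split|].
  - apply Rinv_0_lt_compat. lra.
  - rewrite <- (Rinv_inv e) at 2. apply Rinv_lt_contravar; [|lra].
    apply Rmult_lt_0_compat; lra.
  - rewrite Rinv_inv. lra.
Qed.

Lemma Un_cv_near u l e : Un_cv u l -> 0 < e ->
  exists N, forall n, (N <= n)%nat -> l - e < u n < l + e.
Proof.
  intros H He. destruct (H e He) as [N HN]. exists N. intros n Hn.
  specialize (HN n Hn). unfold Rdist in HN. apply Rabs_def2 in HN. lra.
Qed.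

Lemma Un_cv_frequently_le u l B :
  Un_cv u l -> (forall N, exists n, (N <= n)%nat /\ u n <= B) -> l <= B.
Proof.
  intros Hu HB. apply le_of_le_add_eps; intros e He.
  destruct (Hu e He) as [N HN]. destruct (HB N) as [n [Hn Hn']].
  specialize (HN n Hn). unfold Rdist in HN. apply Rabs_def2 in HN. lra.
Qed.

Lemma Un_cv_subseq u l (phi : nat -> nat) :
  (forall n, (n <= phi n)%nat) -> Un_cv u l -> Un_cv (fun n => u (phi n)) l.
Proof.
  intros Hp Hu e He. destruct (Hu e He) as [N HN]. exists N. intros n Hn.
  apply HN. specialize (Hp n). lia.
Qed.

Lemma strict_mono_ge_id (phi : nat -> nat) :
  (forall n, (phi n < phi (S n))%nat) -> forall n, (n <= phi n)%nat.
Proof. intros H n. induction n; [lia|]. specialize (H n). lia. Qed.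

Lemma Cauchy_exists_limit u : Cauchy_crit u -> exists l, Un_cv u l.
Proof. intros H. destruct (R_complete u H) as [l Hl]. exists l; auto. Qed.

(** Bolzano-Weierstrass supplies only a cluster value [l]. The subsequence is built recursively:
    [next N k] is an index beyond [N] at which [u] is within [1 / (k + 1)] of [l]. *)
Lemma bounded_subseq_cv (u : nat -> R) B :
  (forall n, Rabs (u n) <= B) ->
  exists phi l, (forall n, (phi n < phi (S n))%nat) /\ Un_cv (fun n => u (phi n)) l.
Proof.
  intros HB.
  destruct (@Bolzano_Weierstrass u (fun x => - B <= x <= B)) as [l Hl].
  { apply compact_P3. }
  { intros n. specialize (HB n). unfold Rabs in HB. destruct (Rcase_abs (u n)); lra. }
  assert (Hx : forall N k : nat, exists p, (N < p)%nat /\ Rabs (u p - l) < / INR (S k)).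
  { intros N k.
    destruct (Hl (fun y => Rabs (y - l) < / INR (S k)) (S N)) as [p [Hp Hp']].
    - assert (Hk : 0 < / INR (S k)) by (apply Rinv_0_lt_compat; apply lt_0_INR; lia).
      exists (mkposreal _ Hk). intros y Hy. exact Hy.
    - exists p. split; [lia | exact Hp']. }
  set (next := fun N k => proj1_sig (constructive_indefinite_description _ (Hx N k))).
  assert (Hnext : forall N k, (N < next N k)%nat /\ Rabs (u (next N k) - l) < / INR (S k)).
  { intros N k. unfold next. apply proj2_sig. }
  set (phi := fix phi n := match n with O => next O O | S m => next (phi m) (S m) end).
  assert (Hphi : forall n, Rabs (u (phi n) - l) < / INR (S n)).
  { intros [|n]; simpl phi; apply Hnext. }
  exists phi, l. split.
  - intros n. simpl phi. apply Hnext.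
  - intros e He. destruct (archimed_cor1 e He) as [N [HN HN0]].
    exists N. intros n Hn. unfold Rdist. eapply Rlt_trans; [apply Hphi|].
    eapply Rle_lt_trans; [|exact HN]. apply Rinv_le_contravar.
    + apply lt_0_INR; lia.
    + apply le_INR; lia.
Qed.

(** Cantor's diagonal argument: [Phi k] are nested index sequences, and for [n >= k] the entry
    [Phi n n] is a value of [Phi k] at some index at least [n]. Only [n <= theta n] is recorded,
    which suffices to transport limits. *)
Lemma diagonal_subseq (v : nat -> nat -> R) (B : nat -> R) :
  (forall k n, Rabs (v k n) <= B k) ->
  exists theta : nat -> nat, (forall n, (n <= theta n)%nat) /\
    forall k, exists l, Un_cv (fun n => v k (theta n)) l.
Proof.
  intros HB.
  assert (Hx : forall k (phi : nat -> nat), exists psi : nat -> nat,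
    (forall n, (psi n < psi (S n))%nat) /\
    exists l, Un_cv (fun n => v k (phi (psi n))) l).
  { intros k phi.
    destruct (@bounded_subseq_cv (fun n => v k (phi n)) (B k)) as [psi [l [H1 H2]]]; eauto. }
  set (ext := fun k phi => proj1_sig (constructive_indefinite_description _ (Hx k phi))).
  assert (Hext : forall k phi, (forall n, (ext k phi n < ext k phi (S n))%nat) /\
    exists l, Un_cv (fun n => v k (phi (ext k phi n))) l).
  { intros k phi. unfold ext. apply proj2_sig. }
  set (Phi := fix Phi k := match k with
    | O => ext O (fun n => n)
    | S j => fun n => Phi j (ext (S j) (Phi j) n) end).
  assert (Hcv : forall k, exists l, Un_cv (fun n => v k (Phi k n)) l).
  { intros [|k]; simpl Phi.
    - apply (proj2 (Hext O (fun n => n))).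
    - apply (proj2 (Hext (S k) (Phi k))). }
  assert (Hsub : forall k m, exists sg : nat -> nat, (forall n, (n <= sg n)%nat) /\
     forall n, Phi (k + m)%nat n = Phi k (sg n)).
  { intros k m. induction m as [|m [sg [H1 H2]]].
    - exists (fun n => n). split; [lia|]. intros n. f_equal. lia.
    - exists (fun n => sg (ext (S (k + m)) (Phi (k + m)%nat) n)). split.
      + intros n. etransitivity; [|apply H1].
        apply strict_mono_ge_id. apply (proj1 (Hext (S (k + m)) (Phi (k + m)%nat))).
      + intros n. replace (k + S m)%nat with (S (k + m)) by lia. simpl Phi. apply H2. }
  exists (fun n => Phi n n). split.
  - intros n. destruct (Hsub O n) as [sg [H1 H2]].
    simpl plus in H2. rewrite H2. simpl Phi. etransitivity; [apply H1|].
    apply strict_mono_ge_id. apply (proj1 (Hext O (fun n => n))).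
  - intros k. destruct (Hcv k) as [l Hl]. exists l. intros e He.
    destruct (Hl e He) as [N HN]. exists (N + k)%nat. intros n Hn.
    destruct (Hsub k (n - k)%nat) as [sg [H1 H2]].
    replace (k + (n - k))%nat with n in H2 by lia. rewrite H2. apply HN.
    specialize (H1 n). lia.
Qed.

(** * Rays and horofunctions *)

Section CAT0Space.
Variable T : Type.
Variable d : T -> T -> R.
Hypothesis Hm : is_metric d.

Lemma metric_pos x y : 0 <= d x y.
Proof. apply Hm. Qed.
Lemma metric_refl x : d x x = 0.
Proof. apply (proj1 (proj2 Hm)); reflexivity. Qed.
Lemma metric_eq0 x y : d x y = 0 -> x = y.
Proof. apply (proj1 (proj2 Hm)). Qed.
Lemma metric_sym x y : d x y = d y x.
Proof. apply (proj1 (proj2 (proj2 Hm))). Qed.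
Lemma metric_tri x y z : d x z <= d x y + d y z.
Proof. apply (proj2 (proj2 (proj2 Hm))). Qed.

Lemma geodesic_dist_left p q g s : geodesic d p q g -> 0 <= s <= d p q -> d p (g s) = s.
Proof.
  intros [H0 [H1 H2]] Hs. rewrite <- H0 at 1. rewrite H2; try lra.
  rewrite Rabs_left1; lra.
Qed.

Lemma geodesic_dist_right p q g s :
  geodesic d p q g -> 0 <= s <= d p q -> d (g s) q = d p q - s.
Proof.
  intros [H0 [H1 H2]] Hs. rewrite <- H1 at 1. rewrite H2; try lra.
  rewrite Rabs_left1; lra.
Qed.

Lemma geod_ray_geodesic x c t :
  geod_ray d x c -> 0 <= t -> d x (c t) = t /\ geodesic d x (c t) c.
Proof.
  intros [H0 H1] Ht.
  assert (E : d x (c t) = t).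
  { rewrite <- H0 at 1. rewrite H1; try lra. rewrite Rabs_left1; lra. }
  split; auto. unfold geodesic. rewrite E. repeat split; auto.
  intros s u Hs Hu. apply H1; lra.
Qed.

Lemma geod_ray_shift x c u :
  geod_ray d x c -> 0 <= u -> geod_ray d (c u) (fun t => c (u + t)).
Proof.
  intros [H0 H1] Hu. split; [f_equal; lra|].
  intros s t Hs Ht. rewrite H1; try lra. f_equal; lra.
Qed.

Hypothesis Hc : CAT0 d.

(** The CAT(0) inequality with the second point at the vertex [r] itself is Stewart's formula turned
    into an inequality. Clearing the denominator [d p q] makes it cover degenerate triangles too. *)
Lemma CAT0_stewart p q g s r : geodesic d p q g -> 0 <= s <= d p q ->
  d p q * (d (g s) r)² <=
    (d p q - s) * (d p r)² + s * (d q r)² - s * (d p q - s) * d p q.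
Proof.
  intros Hg Hs. pose proof (metric_pos p r) as Hr0.
  destruct (Req_dec (d p q) 0) as [Ea|Ea].
  { rewrite Ea in *. replace s with 0 by lra. lra. }
  destruct (Req_dec (d p r) 0) as [Er|Er].
  { apply metric_eq0 in Er. subst r. rewrite (metric_sym (g s) p), metric_refl.
    rewrite (geodesic_dist_left Hg Hs). rewrite (metric_sym q p). unfold Rsqr. nra. }
  destruct (proj1 Hc p r) as [g2 Hg2].
  pose proof (proj2 Hc p q r g g2 Hg Hg2 ltac:(lra) ltac:(lra) s (d p r) Hs ltac:(lra)) as H.
  rewrite (proj1 (proj2 Hg2)) in H.
  apply (Rmult_le_compat_l (d p q)) in H; [|lra].
  eapply Rle_trans; [exact H|]. right. unfold Rsqr. field. split; auto.
Qed.

Lemma dist_geodesic_convex p q g s r : geodesic d p q g -> 0 <= s <= d p q ->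
  d p q * d (g s) r <= (d p q - s) * d p r + s * d q r.
Proof.
  intros Hg Hs. pose proof (CAT0_stewart r Hg Hs) as H.
  pose proof (metric_pos p r). pose proof (metric_pos q r). pose proof (metric_pos p q).
  pose proof (metric_pos (g s) r).
  pose proof (metric_tri p q r) as Q1. pose proof (metric_tri q p r) as Q2.
  rewrite (metric_sym q p) in Q2. pose proof (metric_tri p r q) as Q3. rewrite (metric_sym r q) in Q3.
  set (a := d p q) in *. set (b := d p r) in *. set (c := d q r) in *. set (D := d (g s) r) in *.
  apply Rsqr_le_inv_nonneg; [|nra].
  (* The square of the right-hand side exceeds [a] times the Stewart bound by exactly
     [s * (a - s) * (a² - (b - c)²)], nonnegative by the triangle inequality. *)
  assert (Hk : (b - c)² <= a²) by (apply Rsqr_le_abs_1; unfold Rabs; destruct (Rcase_abs (b - c)), (Rcase_abs a); lra).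
  assert (Hk2 : 0 <= s * (a - s) * (a² - (b - c)²)) by (apply Rmult_le_pos; [nra|lra]).
  apply (Rmult_le_compat_l a) in H; [|lra].
  unfold Rsqr in *. nra.
Qed.

Lemma CN_midpoint p q :
  exists g, geodesic d p q g /\ 0 <= d p q / 2 <= d p q /\
    forall r, (d (g (d p q / 2)) r)² <= ((d p r)² + (d q r)²) / 2 - (d p q)² / 4.
Proof.
  destruct (proj1 Hc p q) as [g Hg]. pose proof (metric_pos p q) as Ha.
  exists g. split; auto. split; [lra|]. intros r.
  destruct (Req_dec (d p q) 0) as [E|E].
  - pose proof E as E'. apply metric_eq0 in E'. subst q. rewrite E.
    replace (0 / 2) with 0 by lra. rewrite (proj1 Hg). unfold Rsqr. lra.
  - pose proof (CAT0_stewart (s:=d p q / 2) r Hg ltac:(lra)) as H.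
    apply (Rmult_le_reg_l (d p q)); [lra|]. unfold Rsqr in *. nra.
Qed.

(** The one-sided bound gives 1-Lipschitz by symmetry of [d]; convexity along geodesics is written
    without dividing by [d p q]. The midpoint arguments below use Busemann functions through these
    two properties. *)
Definition convex_lip (f : T -> R) : Prop :=
  (forall y z, f y - f z <= d y z) /\
  (forall p q g s, geodesic d p q g -> 0 <= s <= d p q ->
     d p q * f (g s) <= (d p q - s) * f p + s * f q).

Lemma convex_lip_mid f p q g : convex_lip f -> geodesic d p q g ->
  f (g (d p q / 2)) <= (f p + f q) / 2.
Proof.
  intros [Hl Hf] Hg. pose proof (metric_pos p q) as Ha.
  destruct (Req_dec (d p q) 0) as [E|E].
  - pose proof E as E'. apply metric_eq0 in E'. subst q. rewrite E.
    replace (0 / 2) with 0 by lra. rewrite (proj1 Hg). lra.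
  - apply (Rmult_le_reg_l (d p q)); [lra|].
    pose proof (Hf p q g (d p q / 2) Hg ltac:(lra)). lra.
Qed.

(* The midpoint of p and q cannot descend below [f x - t] while being closer to [x] than [t]. *)
Lemma descent_point_unique f x t p q : convex_lip f -> 0 <= t ->
  d x p <= t -> d x q <= t -> f p <= f x - t -> f q <= f x - t -> p = q.
Proof.
  intros Hf Ht Hp Hq Fp Fq.
  destruct (CN_midpoint p q) as [g [Hg [_ Hr]]].
  pose proof (convex_lip_mid Hf Hg) as Hmid. specialize (Hr x).
  set (m := g (d p q / 2)) in *.
  pose proof (proj1 Hf x m) as Hl. rewrite (metric_sym x m) in Hl.
  pose proof (metric_pos p q). pose proof (metric_pos x p). pose proof (metric_pos x q).
  rewrite (metric_sym p x), (metric_sym q x) in Hr.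
  apply metric_eq0. unfold Rsqr in Hr.
  assert (t * t <= d m x * d m x) by nra.
  assert (d x p * d x p <= t * t) by nra. assert (d x q * d x q <= t * t) by nra. nra.
Qed.

Lemma convex_lip_ray f x c s t : convex_lip f -> geod_ray d x c -> 0 <= s <= t ->
  t * f (c s) <= (t - s) * f x + s * f (c t).
Proof.
  intros [_ Hf] Hr Hs. destruct (geod_ray_geodesic (t:=t) Hr ltac:(lra)) as [E G].
  pose proof (Hf _ _ _ s G). rewrite E in H. apply H. lra.
Qed.

Hypothesis Hp : proper d.
Variable x0 : T.

(** A sequential form of boundary points: pointwise limits of [iota] along a sequence leaving every
    ball. [bdry_horo] and [horo_bdry] identify it with [bdry]. *)
Definition horo (f : T -> R) (u : nat -> T) : Prop :=
  (forall r, exists N, forall n, (N <= n)%nat -> r < d x0 (u n)) /\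
  forall y, Un_cv (fun n => iota d x0 (u n) y) (f y).

Lemma horo_base f u : horo f u -> f x0 = 0.
Proof.
  intros [_ H]. specialize (H x0). eapply UL_sequence; [exact H|].
  intros e He. exists O. intros n _. unfold Rdist, iota.
  replace (d (u n) x0 - d (u n) x0 - 0) with 0 by lra. rewrite Rabs_R0. lra.
Qed.

Lemma horo_convex_lip f u : horo f u -> convex_lip f.
Proof.
  intros [_ H]. split.
  - intros y z. apply le_of_le_add_eps; intros e He.
    destruct (Un_cv_near (e := e / 2) (H y) ltac:(lra)) as [N1 HN1].
    destruct (Un_cv_near (e := e / 2) (H z) ltac:(lra)) as [N2 HN2].
    specialize (HN1 (N1 + N2)%nat ltac:(lia)). specialize (HN2 (N1 + N2)%nat ltac:(lia)).
    set (n := (N1 + N2)%nat) in *. unfold iota in *.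
    pose proof (metric_tri (u n) z y). rewrite (metric_sym z y) in H0. lra.
  - intros p q g s Hg Hs.
    assert (E : Un_cv (fun n => (d p q - s) * iota d x0 (u n) p + s * iota d x0 (u n) q
                         - d p q * iota d x0 (u n) (g s))
                ((d p q - s) * f p + s * f q - d p q * f (g s))).
    { apply CV_minus; [apply CV_plus|]; apply CV_mult; auto;
      intros e He; exists O; intros; unfold Rdist; rewrite Rminus_diag, Rabs_R0; lra. }
    assert (0 <= (d p q - s) * f p + s * f q - d p q * f (g s)); [|lra].
    apply CV_opp in E. apply (Un_cv_frequently_le (B:=0)) in E; [lra|].
    intros N. exists N. split; [lia|]. unfold opp_seq, iota.
    pose proof (dist_geodesic_convex (u N) Hg Hs).
    rewrite (metric_sym (u N) p), (metric_sym (u N) q), (metric_sym (u N) (g s)). nra.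
Qed.

(** [p] is a cluster point of the points at distance [t] from [x] on geodesics towards [u n]. The
    condition holds frequently rather than eventually, because properness yields only
    subsequences. *)
Definition radial_limit (x : T) (u : nat -> T) (t : R) (p : T) : Prop :=
  forall e N, 0 < e -> exists n g, (N <= n)%nat /\ geodesic d x (u n) g /\
     t <= d x (u n) /\ d (g t) p < e.

Lemma horo_far f u x r : horo f u -> exists N, forall n, (N <= n)%nat -> r < d x (u n).
Proof.
  intros [H _]. destruct (H (r + d x0 x)) as [N HN]. exists N. intros n Hn.
  specialize (HN n Hn). pose proof (metric_tri x0 x (u n)). lra.
Qed.

Lemma radial_limit_exists f u x t : horo f u -> 0 <= t ->
  exists p, d x p = t /\ radial_limit x u t p.
Proof.
  intros Hh Ht. destruct (horo_far x t Hh) as [N HN].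
  assert (Hg : forall n, exists g, geodesic d x (u (N + n)%nat) g) by (intros; apply Hc).
  apply choice in Hg. destruct Hg as [g Hg].
  assert (Hgt : forall n, d x (g n t) = t).
  { intros n. eapply geodesic_dist_left; [apply Hg|]. specialize (HN (N + n)%nat ltac:(lia)). lra. }
  destruct (Hp (x:=x) (r:=t) (fun n => g n t)) as [phi [p [Hphi Hcv]]].
  { intros n. rewrite Hgt. lra. }
  pose proof (strict_mono_ge_id _ Hphi) as Hid.
  assert (HL : radial_limit x u t p).
  { intros e K He. destruct (Hcv e He) as [K' HK'].
    specialize (HK' (K + K')%nat ltac:(lia)). cbv beta in HK'.
    exists (N + phi (K + K'))%nat, (g (phi (K + K')%nat)).
    specialize (Hid (K + K')%nat). split; [lia|]. split; [apply Hg|]. split; auto.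
    left. apply HN. lia. }
  exists p. split; auto.
  apply Rle_antisym; apply le_of_le_add_eps; intros e He;
    destruct (Hcv e He) as [K HK]; specialize (HK K ltac:(lia)); cbv beta in HK;
    pose proof (Hgt (phi K)) as E.
  - pose proof (metric_tri x (g (phi K) t) p). lra.
  - pose proof (metric_tri x p (g (phi K) t)) as Q. rewrite (metric_sym p) in Q. lra.
Qed.

(** Moving by [t] along a geodesic to [u n] lowers the distance to [u n] by exactly [t], and this
    survives in the limit; the opposite bound is the Lipschitz property. *)
Lemma radial_limit_value f u x t p : horo f u -> 0 <= t -> d x p = t ->
  radial_limit x u t p -> f p = f x - t.
Proof.
  intros Hh Ht Hd HL. apply Rle_antisym.
  2: { pose proof (proj1 (horo_convex_lip Hh) x p). lra. }
  apply le_of_le_add_eps; intros e He.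
  destruct (Un_cv_near (e := e / 4) (proj2 Hh p) ltac:(lra)) as [N1 HN1].
  destruct (Un_cv_near (e := e / 4) (proj2 Hh x) ltac:(lra)) as [N2 HN2].
  destruct (HL (e/4) (N1 + N2)%nat ltac:(lra)) as [n [g [Hn [Hg [Hle Hlt]]]]].
  specialize (HN1 n ltac:(lia)). specialize (HN2 n ltac:(lia)). unfold iota in *.
  pose proof (geodesic_dist_right Hg (conj Ht Hle)) as E.
  pose proof (metric_tri (u n) (g t) p) as Q. rewrite (metric_sym (u n) (g t)) in Q.
  rewrite (metric_sym (u n) x) in *. lra.
Qed.

(** The hard half of the convergence of [d y (c t) - t] to [f y - f x] along a ray, with an explicit
    error of order [1 / t]. The other half is the Lipschitz property of [f]. *)
Lemma radial_limit_dist f u x t p y : horo f u -> d x y < t ->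
  radial_limit x u t p ->
  d p y <= t + (f y - f x) + (d x y)² / (2 * (t - d x y)).
Proof.
  intros Hh Hy HL. set (rho := d x y) in *. pose proof (metric_pos x y) as Hr. fold rho in Hr.
  apply le_of_le_add_eps; intros e He.
  destruct (Un_cv_near (e := e / 4) (proj2 Hh y) ltac:(lra)) as [N1 HN1].
  destruct (Un_cv_near (e := e / 4) (proj2 Hh x) ltac:(lra)) as [N2 HN2].
  destruct (HL (e/4) (N1 + N2)%nat ltac:(lra)) as [n [g [Hn [Hg [Hle Hlt]]]]].
  specialize (HN1 n ltac:(lia)). specialize (HN2 n ltac:(lia)). unfold iota in *.
  pose proof (CAT0_stewart (s:=t) y Hg ltac:(lra)) as S. fold rho in S.
  pose proof (metric_tri (u n) x y) as Q1. pose proof (metric_tri x y (u n)) as Q2.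
  fold rho in Q1, Q2. rewrite (metric_sym y (u n)) in Q2. rewrite (metric_sym (u n) x) in *.
  pose proof (metric_tri p (g t) y) as Q3. rewrite (metric_sym p (g t)) in Q3.
  set (a := d x (u n)) in *. set (c := d (u n) y) in *. set (D := d (g t) y) in *.
  (* With [h = c - a], Stewart reads [a D² <= a (t + h)² + (a - t) (rho² - h²)], whence
     [D² <= (t + h)² + rho²]. *)
  assert (HD : D <= (t + (c - a)) + rho² / (2 * (t + (c - a)))).
  { apply sqrt_bound; [lra|].
    apply (Rmult_le_reg_l a); [lra|]. eapply Rle_trans; [exact S|].
    assert (0 <= rho² - (c - a)²) by (unfold Rsqr; nra).
    assert (0 <= (a * rho² - (a - t) * (rho² - (c - a)²))).
    { pose proof (Rle_0_sqr (c - a)). nra. }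
    unfold Rsqr in *. nra. }
  assert (rho² / (2 * (t + (c - a))) <= rho² / (2 * (t - rho))).
  { apply Rmult_le_compat_l; [apply Rle_0_sqr|]. apply Rinv_le_contravar; lra. }
  lra.
Qed.

(** The points [c t] are chosen independently as radial limits, yet they fit together: the point at
    distance [s] on the geodesic from [x] to [c t] descends by [s], so [descent_point_unique]
    identifies it with [c s]. *)
Lemma horo_ray_exists f u x : horo f u -> exists c, ray_to d x0 x f c.
Proof.
  intros Hh.
  assert (HH : forall t, exists p, 0 <= t -> d x p = t /\ radial_limit x u t p).
  { intros t. destruct (Rle_dec 0 t) as [h|h].
    - destruct (radial_limit_exists x Hh h) as [p Hpp]. exists p. auto.
    - exists x. lra. }
  apply choice in HH. destruct HH as [c Hcc].
  pose proof (horo_convex_lip Hh) as Hcl.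
  assert (Hv : forall t, 0 <= t -> f (c t) = f x - t).
  { intros t Ht. destruct (Hcc t Ht). eapply radial_limit_value; eauto. }
  assert (Hst : forall s t, 0 <= s <= t -> d (c s) (c t) = t - s).
  { intros s t Hs. destruct (Hcc t ltac:(lra)) as [E _].
    destruct (proj1 Hc x (c t)) as [g Hg].
    pose proof (geodesic_dist_left (s:=s) Hg ltac:(lra)) as E1.
    pose proof (geodesic_dist_right (s:=s) Hg ltac:(lra)) as E2.
    assert (Eg : g s = c s).
    { apply (descent_point_unique (f:=f) (x:=x) (t:=s)); auto; try lra.
      - destruct (Hcc s ltac:(lra)). lra.
      - pose proof (proj1 Hcl (g s) (c t)). rewrite (Hv t) in H by lra. lra.
      - rewrite Hv; lra. }
    rewrite <- Eg. lra. }
  exists c. split; [split|].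
  - destruct (Hcc 0 ltac:(lra)) as [E _]. apply metric_eq0 in E. auto.
  - intros s t Hs Ht. destruct (Rle_dec s t).
    + rewrite Hst by lra. rewrite Rabs_left1; lra.
    + rewrite metric_sym, Hst by lra. rewrite Rabs_pos_eq; lra.
  - assert (K : forall y e, 0 < e -> exists t0, forall t, t0 <= t ->
        0 <= d y (c t) - (t + (f y - f x)) < e).
    { intros y e He. set (rho := d x y). pose proof (metric_pos x y) as Hr. fold rho in Hr.
      pose proof (Rle_0_sqr rho) as Hr2.
      assert (He2 : 0 <= rho² / e) by (apply Rmult_le_pos; auto; left; apply Rinv_0_lt_compat; lra).
      (* Beyond this threshold [t - rho > rho² / e], so the error term of [radial_limit_dist] is
         below [e]. *)
      exists (rho + rho² / e + 1). intros t Ht.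
      assert (Hlt : d x y < t) by (fold rho; lra).
      pose proof (radial_limit_dist Hh Hlt (proj2 (Hcc t ltac:(lra)))) as B.
      fold rho in B. rewrite metric_sym.
      pose proof (proj1 Hcl y (c t)) as B2. rewrite Hv in B2 by lra. rewrite (metric_sym y) in B2.
      split; [lra|].
      assert (rho² / (2 * (t - rho)) < e); [|lra].
      apply (Rmult_lt_reg_r (2 * (t - rho))); [lra|].
      unfold Rdiv. rewrite Rmult_assoc, Rinv_l by lra. rewrite Rmult_1_r.
      assert (rho² = e * (rho² / e)) by (field; lra). nra. }
    (* [ray_to] normalizes by [d x0 (c t)] instead of [t], so [K] is used at [y] and at [x0], where
       [f] vanishes. *)
    intros y e He. destruct (K y e He) as [t1 H1]. destruct (K x0 e He) as [t2 H2].
    rewrite (horo_base Hh) in H2.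
    exists (Rmax t1 t2). intros t Ht.
    pose proof (Rmax_l t1 t2). pose proof (Rmax_r t1 t2).
    specialize (H1 t ltac:(lra)). specialize (H2 t ltac:(lra)).
    apply Rabs_def1; lra.
Qed.

(** Compare the defining limit at [c t] and at [x]: for large [s] their distances to [c s] are
    [s - t] and [s]. *)
Lemma ray_to_value x f c t : ray_to d x0 x f c -> 0 <= t -> f (c t) = f x - t.
Proof.
  intros [Hr Hf] Ht.
  assert (forall e, 0 < e -> Rabs (f (c t) - (f x - t)) < e).
  { intros e He. destruct (Hf (c t) (e / 2) ltac:(lra)) as [t1 H1].
    destruct (Hf x (e / 2) ltac:(lra)) as [t2 H2].
    pose proof (Rmax_l t (Rmax t1 t2)). pose proof (Rmax_r t (Rmax t1 t2)).
    pose proof (Rmax_l t1 t2). pose proof (Rmax_r t1 t2).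
    set (s := Rmax t (Rmax t1 t2)) in *.
    specialize (H1 s ltac:(lra)). specialize (H2 s ltac:(lra)).
    assert (Hs0 : 0 <= s) by lra.
    rewrite (proj2 Hr) in H1 by lra. rewrite (Rabs_left1 (t - s)) in H1 by lra.
    rewrite (proj1 (geod_ray_geodesic Hr Hs0)) in H2.
    apply Rabs_def2 in H1, H2. apply Rabs_def1; lra. }
  destruct (Req_dec (f (c t)) (f x - t)) as [E|E]; auto.
  specialize (H (Rabs (f (c t) - (f x - t))) ltac:(apply Rabs_pos_lt; lra)). lra.
Qed.

(** By convexity the midpoint of [c t] and [c' t] has [f]-value at most [f x - t + d x x' / 2], so
    it is at distance at least [t - d x x' / 2] from [x]. The CN inequality at [x] then bounds the
    gap between the rays. *)
Lemma ray_to_asymptotic f x x' c c' t : convex_lip f ->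
  ray_to d x0 x f c -> ray_to d x0 x' f c' -> 0 <= t -> d x x' <= 2 * t ->
  (d (c t) (c' t))² <= 8 * t * d x x' + (d x x')².
Proof.
  intros Hf Hr Hr' Ht HD.
  destruct (CN_midpoint (c t) (c' t)) as [g [Hg [_ H]]]. specialize (H x).
  pose proof (convex_lip_mid Hf Hg) as Hmid. set (m := g (d (c t) (c' t) / 2)) in *.
  rewrite (ray_to_value Hr Ht), (ray_to_value Hr' Ht) in Hmid.
  pose proof (proj1 Hf x m) as L1. rewrite (metric_sym x m) in L1.
  pose proof (proj1 Hf x' x) as L2. rewrite (metric_sym x' x) in L2.
  pose proof (proj1 (geod_ray_geodesic (proj1 Hr) Ht)) as E1.
  pose proof (proj1 (geod_ray_geodesic (proj1 Hr') Ht)) as E2.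
  pose proof (metric_tri (c' t) x' x) as L3.
  rewrite (metric_sym (c' t) x'), E2, (metric_sym x' x) in L3.
  rewrite (metric_sym (c t) x), E1 in H.
  pose proof (metric_pos x x'). pose proof (metric_pos (c' t) x). pose proof (metric_pos m x).
  set (D := d x x') in *. unfold Rsqr in *.
  assert (d (c' t) x * d (c' t) x <= (t + D) * (t + D)) by nra.
  assert ((t - D/2) * (t - D/2) <= d m x * d m x) by nra.
  nra.
Qed.

Lemma ray_to_shift f x c u : ray_to d x0 x f c -> 0 <= u ->
  ray_to d x0 (c u) f (fun t => c (u + t)).
Proof.
  intros [Hr Hf] Hu. split; [eapply geod_ray_shift; eauto|].
  intros y e He. destruct (Hf y e He) as [t0 H0]. exists t0. intros t Ht. apply H0. lra.
Qed.

End CAT0Space.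

(** * Suprema and infima of real sets, and monotonicity of the cosine *)

Lemma Rsup_ub (E : R -> Prop) B x : (forall y, E y -> y <= B) -> E x -> x <= Rsup E.
Proof.
  intros HB Hx. unfold Rsup.
  destruct (excluded_middle_informative _) as [H|H].
  - destruct (completeness E (proj1 H) (proj2 H)) as [l Hl]. simpl. apply Hl; auto.
  - exfalso. apply H. split; [exists B; exact HB | exists x; exact Hx].
Qed.

Lemma Rsup_le (E : R -> Prop) B : (exists x, E x) -> (forall y, E y -> y <= B) -> Rsup E <= B.
Proof.
  intros Hx HB. unfold Rsup.
  destruct (excluded_middle_informative _) as [H|H].
  - destruct (completeness E (proj1 H) (proj2 H)) as [l Hl]. simpl. apply Hl. exact HB.
  - exfalso. apply H. split; [exists B; exact HB | exact Hx].
Qed.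

Lemma Rinf_lb (E : R -> Prop) B x : (forall y, E y -> B <= y) -> E x -> Rinf E <= x.
Proof.
  intros HB Hx. unfold Rinf.
  assert (- x <= Rsup (fun z => E (- z))); [|lra].
  apply Rsup_ub with (- B).
  - intros y Hy. specialize (HB _ Hy). lra.
  - rewrite Ropp_involutive. exact Hx.
Qed.

Lemma Rinf_ge (E : R -> Prop) B : (exists x, E x) -> (forall y, E y -> B <= y) -> B <= Rinf E.
Proof.
  intros [x Hx] HB. unfold Rinf.
  assert (Rsup (fun z => E (- z)) <= - B); [|lra].
  apply Rsup_le.
  - exists (- x). rewrite Ropp_involutive. exact Hx.
  - intros y Hy. specialize (HB _ Hy). lra.
Qed.

Lemma Rinf_lt_witness (E : R -> Prop) a : (exists x, E x) -> Rinf E < a -> exists x, E x /\ x < a.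
Proof.
  intros Hne H. apply NNPP. intros Hn.
  assert (a <= Rinf E); [|lra].
  apply Rinf_ge; auto. intros y Hy. apply Rnot_lt_le. intros Hlt. apply Hn. exists y; auto.
Qed.

Lemma angle_le_cos a b : 0 <= a <= PI -> 0 <= b <= PI -> a <= b -> cos b <= cos a.
Proof.
  intros Ha Hb [H|H]; [left; apply cos_decreasing_1; lra | subst; lra].
Qed.

Lemma cos_le_angle a b : 0 <= a <= PI -> 0 <= b <= PI -> cos b <= cos a -> a <= b.
Proof.
  intros Ha Hb H. apply Rnot_lt_le. intros Hlt.
  pose proof (cos_decreasing_1 b a). lra.
Qed.

Lemma Rdiv_mult_cancel x y : y <> 0 -> x / y * y = x.
Proof. intros H. field. exact H. Qed.

(** * The Tits angle as a slope *)

Section Angles.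
Variable T : Type.
Variable d : T -> T -> R.
Hypothesis Hm : is_metric d.

Lemma comparison_angle_cos x p q : 0 < d x p -> 0 < d x q ->
  cos (comparison_angle d x p q) =
  ((d x p)² + (d x q)² - (d p q)²) / (2 * d x p * d x q).
Proof.
  intros Hp Hq. unfold comparison_angle. apply cos_acos.
  pose proof (metric_tri Hm p x q) as Q1. rewrite (metric_sym Hm p x) in Q1.
  pose proof (metric_tri Hm x p q) as Q2.
  pose proof (metric_tri Hm x q p) as Q3. rewrite (metric_sym Hm q p) in Q3.
  pose proof (metric_pos Hm p q) as Q0.
  set (a := d x p) in *. set (b := d x q) in *. set (c := d p q) in *.
  assert (H : 0 < 2 * a * b) by nra. unfold Rsqr.
  split; apply (Rmult_le_reg_r (2 * a * b)); auto;
    rewrite Rdiv_mult_cancel by lra.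
  - assert (c * c <= (a + b) * (a + b)) by nra. nra.
  - assert ((a - b) * (a - b) <= c * c); [|nra].
    apply Rsqr_le_abs_1. unfold Rabs. destruct (Rcase_abs (a - b)), (Rcase_abs c); lra.
Qed.

Lemma comparison_angle_bound x p q : 0 <= comparison_angle d x p q <= PI.
Proof. apply acos_bound. Qed.

Lemma comparison_sup_bound x (c c' : R -> T) e : 0 < e ->
  let S := fun b => exists t t', 0 < t < e /\ 0 < t' < e /\
                 b = comparison_angle d x (c t) (c' t') in
  0 <= Rsup S <= PI.
Proof.
  intros He S.
  assert (HB : forall y, S y -> y <= PI).
  { intros y (t & t' & _ & _ & ->). apply comparison_angle_bound. }
  assert (Hx : S (comparison_angle d x (c (e/2)) (c' (e/2)))).
  { exists (e/2), (e/2). repeat split; lra. }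
  split.
  - eapply Rle_trans; [|apply (@Rsup_ub S PI _ HB Hx)]. apply comparison_angle_bound.
  - apply Rsup_le; eauto.
Qed.

Lemma alexandrov_angle_bound (c c' : R -> T) : 0 <= alexandrov_angle d c c' <= PI.
Proof.
  unfold alexandrov_angle. split.
  - apply Rinf_ge.
    + eexists. exists 1. split; [lra|reflexivity].
    + intros y (e & He & ->). apply (comparison_sup_bound (c 0) c c' He).
  - eapply Rle_trans.
    + apply Rinf_lb with (B := 0).
      * intros y (e & He & ->). apply (comparison_sup_bound (c 0) c c' He).
      * exists 1. split; [lra|reflexivity].
    + apply (comparison_sup_bound (c 0) c c' Rlt_0_1).
Qed.

Lemma alexandrov_angle_lt (c c' : R -> T) a : alexandrov_angle d c c' < a ->
  exists e, 0 < e /\ forall t t', 0 < t < e -> 0 < t' < e ->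
    comparison_angle d (c 0) (c t) (c' t') <= a.
Proof.
  intros H. apply Rinf_lt_witness in H.
  - destruct H as [y [(e & He & Ey) Hy]]. exists e. split; auto.
    intros t t' Ht Ht'. left. eapply Rle_lt_trans; [|exact Hy]. rewrite Ey.
    apply Rsup_ub with PI.
    + intros z (s & s' & _ & _ & ->). apply comparison_angle_bound.
    + exists t, t'. auto.
  - eexists. exists 1. split; [lra|reflexivity].
Qed.

Hypothesis Hc : CAT0 d.

(** The CAT(0) inequality in the triangle [x], [c t], [c' t'] says that comparison angles do not
    increase when the two points slide towards [x]. Hence the supremum over parameters below
    [Rmin t t'] is already bounded by the angle at [t], [t']. *)
Lemma alexandrov_angle_le_comparison x c c' t t' :
  geod_ray d x c -> geod_ray d x c' -> 0 < t -> 0 < t' ->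
  alexandrov_angle d c c' <= comparison_angle d x (c t) (c' t').
Proof.
  intros Hr Hr' Ht Ht'.
  set (e := Rmin t t').
  assert (He : 0 < e) by (apply Rmin_pos; auto).
  pose proof (Rmin_l t t') as M1. pose proof (Rmin_r t t') as M2. fold e in M1, M2.
  eapply Rle_trans.
  { apply Rinf_lb with (B := 0).
    - intros y (e' & He' & ->). apply (comparison_sup_bound (c 0) c c' He').
    - exists e. split; [auto|reflexivity]. }
  apply Rsup_le.
  { eexists. exists (e/2), (e/2). split; [lra|]. split; [lra|reflexivity]. }
  intros y (s & s' & Hs & Hs' & ->). rewrite (proj1 Hr).
  destruct (geod_ray_geodesic Hr (t:=t) ltac:(lra)) as [E1 G1].
  destruct (geod_ray_geodesic Hr' (t:=t') ltac:(lra)) as [E2 G2].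
  destruct (geod_ray_geodesic Hr (t:=s) ltac:(lra)) as [E3 _].
  destruct (geod_ray_geodesic Hr' (t:=s') ltac:(lra)) as [E4 _].
  apply cos_le_angle; try apply comparison_angle_bound.
  rewrite !comparison_angle_cos; try lra. rewrite E1, E2, E3, E4.
  pose proof (proj2 Hc _ _ _ _ _ G1 G2 ltac:(lra) ltac:(lra) s s' ltac:(lra) ltac:(lra)) as H.
  rewrite E1, E2 in H.
  apply (Rmult_le_reg_r (2 * s * s')); [nra|].
  rewrite (Rdiv_mult_cancel (s² + s'² - _)) by nra.
  replace ((t² + t'² - (d (c t) (c' t'))²) / (2 * t * t') * (2 * s * s'))
    with (s * s' * (t² + t'² - (d (c t) (c' t'))²) / (t * t')) by (field; lra).
  lra.
Qed.

Hypothesis Hp : proper d.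
Variable x0 : T.

Lemma tits_angle_set_nonempty xi eta u v : horo d x0 xi u -> horo d x0 eta v ->
  exists a x c c', ray_to d x0 x xi c /\ ray_to d x0 x eta c' /\ a = alexandrov_angle d c c'.
Proof.
  intros H1 H2. destruct (horo_ray_exists Hm Hc Hp x0 H1) as [c Hcc].
  destruct (horo_ray_exists Hm Hc Hp x0 H2) as [c' Hcc'].
  exists (alexandrov_angle d c c'), x0, c, c'. auto.
Qed.

Lemma alexandrov_le_tits xi eta x c c' : ray_to d x0 x xi c -> ray_to d x0 x eta c' ->
  alexandrov_angle d c c' <= tits_angle d x0 xi eta.
Proof.
  intros H1 H2. unfold tits_angle. apply Rsup_ub with PI.
  - intros y (? & ? & ? & _ & _ & ->). apply alexandrov_angle_bound.
  - exists x, c, c'. auto.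
Qed.

Lemma tits_angle_bound xi eta u v : horo d x0 xi u -> horo d x0 eta v ->
  0 <= tits_angle d x0 xi eta <= PI.
Proof.
  intros H1 H2. destruct (tits_angle_set_nonempty H1 H2) as (a & x & c & c' & R1 & R2 & E).
  split.
  - eapply Rle_trans; [|eapply alexandrov_le_tits; eauto]. apply alexandrov_angle_bound.
  - apply Rsup_le.
    + exists a, x, c, c'. auto.
    + intros y (? & ? & ? & _ & _ & ->). apply alexandrov_angle_bound.
Qed.

(* Asymptotic rays are at distance O(sqrt t), so the slope at infinity of the
   convex function [eta] is the same along both. *)
Lemma slope_transfer xi eta x c0 c k s : convex_lip d xi -> convex_lip d eta ->
  ray_to d x0 x0 xi c0 -> ray_to d x0 x xi c ->
  (forall t, 0 <= t -> eta (c0 t) <= t * k) ->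
  0 <= s -> eta (c s) <= eta x + s * k.
Proof.
  intros Hxi Heta R0 Rc Hk Hs.
  destruct (Req_dec s 0) as [->|Hs0].
  { rewrite (proj1 (proj1 Rc)). lra. }
  apply Rnot_lt_le. intros Hlt.
  set (del := eta (c s) - eta x - s * k). assert (Hdel : 0 < del) by (unfold del; lra).
  set (D := d x0 x). pose proof (metric_pos Hm x0 x) as HD. fold D in HD.
  set (de := del / (2 * s)).
  assert (Hde : 0 < de) by (apply Rdiv_lt_0_compat; lra).
  assert (Ede : 2 * s * de = del) by (unfold de; field; lra).
  (* An excess [del] at [s] grows by convexity to about [t * del / s] at [t], while the two rays are
     only [de * t = t * del / (2 * s)] apart. The term [9 * D / de²] yields that distance bound, and
     the last fraction makes [eta x] negligible. *)
  set (t := s + D + 9 * D / de² + 2 * s * Rabs (eta x) / del + 1).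
  assert (Hde2 : 0 < de²) by (apply Rlt_0_sqr; lra).
  assert (P1 : 0 <= 9 * D / de²).
  { apply Rmult_le_pos; [lra|]. left. apply Rinv_0_lt_compat; auto. }
  assert (P2 : 0 <= 2 * s * Rabs (eta x) / del).
  { apply Rmult_le_pos; [pose proof (Rabs_pos (eta x)); nra|]. left. apply Rinv_0_lt_compat; auto. }
  assert (Ht : 0 <= t) by (unfold t; lra).
  assert (Q1 : de² * t >= 9 * D).
  { assert (9 * D = de² * (9 * D / de²)) by (field; lra). unfold t. nra. }
  assert (Q2 : del * t > 2 * s * Rabs (eta x)).
  { assert (2 * s * Rabs (eta x) = del * (2 * s * Rabs (eta x) / del)) by (field; lra).
    unfold t. nra. }
  pose proof (ray_to_asymptotic Hm Hc Hxi R0 Rc Ht ltac:(fold D; unfold t; lra)) as H.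
  fold D in H.
  assert (HE : d (c0 t) (c t) <= de * t).
  { apply Rsqr_le_inv_nonneg; [|nra]. eapply Rle_trans; [exact H|].
    assert (D <= t) by (unfold t; lra). unfold Rsqr in *. nra. }
  pose proof (convex_lip_ray (s:=s) (t:=t) Heta (proj1 Rc) ltac:(unfold t; lra)) as Hcv.
  pose proof (proj1 Heta (c t) (c0 t)) as L. rewrite (metric_sym Hm (c t)) in L.
  specialize (Hk t Ht).
  assert (U : eta (c t) <= t * k + de * t) by lra.
  assert (V : t * del <= s * (de * t) - s * eta x).
  { unfold del. nra. }
  pose proof (Rle_abs (- eta x)) as W. rewrite Rabs_Ropp in W. nra.
Qed.

(** At any vertex [x] the angle is at most the comparison angle between [c 1] and a far point
    [c' t]. The cosine of the latter is at least [t - d (c 1) (c' t)], which tends to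
    [eta x - eta (c 1)], and [slope_transfer] bounds this below by [cos a]. *)
Lemma tits_le_of_slope xi eta u v c0 a : horo d x0 xi u -> horo d x0 eta v ->
  ray_to d x0 x0 xi c0 -> 0 <= a <= PI ->
  (forall t, 0 <= t -> eta (c0 t) <= t * - cos a) ->
  tits_angle d x0 xi eta <= a.
Proof.
  intros Hxi Heta R0 Ha Hk. unfold tits_angle. apply Rsup_le.
  { eapply tits_angle_set_nonempty; eauto. }
  intros y (x & c & c' & Rc & Rc' & ->).
  pose proof (horo_convex_lip Hm Hc Hxi) as Cxi.
  pose proof (horo_convex_lip Hm Hc Heta) as Ceta.
  pose proof (slope_transfer Cxi Ceta R0 Rc Hk Rle_0_1) as H1.
  apply cos_le_angle; auto; [apply alexandrov_angle_bound|].
  apply le_of_le_add_eps. intros e He.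
  destruct (proj2 Rc' (c 1) (e/2) ltac:(lra)) as [t1 B1].
  destruct (proj2 Rc' x (e/2) ltac:(lra)) as [t2 B2].
  set (t := Rmax 1 (Rmax t1 t2)).
  pose proof (Rmax_l 1 (Rmax t1 t2)) as M1. pose proof (Rmax_r 1 (Rmax t1 t2)) as M2.
  pose proof (Rmax_l t1 t2). pose proof (Rmax_r t1 t2). fold t in M1, M2.
  specialize (B1 t ltac:(lra)). specialize (B2 t ltac:(lra)).
  assert (Ht : 0 <= t) by lra. assert (Ht1 : 0 < t) by lra.
  destruct (geod_ray_geodesic (proj1 Rc') Ht) as [E _].
  destruct (geod_ray_geodesic (proj1 Rc) Rle_0_1) as [E1 _].
  rewrite E in B2. apply Rabs_def2 in B1, B2.
  pose proof (alexandrov_angle_le_comparison (proj1 Rc) (proj1 Rc') Rlt_0_1 Ht1) as K.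
  apply angle_le_cos in K; [|apply alexandrov_angle_bound|apply comparison_angle_bound].
  rewrite comparison_angle_cos in K by lra. rewrite E, E1 in K.
  (* With [D = d (c 1) (c' t)], the right side minus the left is [(1 - (t - D)²) / (2 * t)], and
     [|t - D| <= 1]. *)
  assert (K2 : t - d (c 1) (c' t) <= (1² + t² - (d (c 1) (c' t))²) / (2 * 1 * t)).
  { pose proof (metric_tri Hm x (c 1) (c' t)) as T1. rewrite E, E1 in T1.
    pose proof (metric_tri Hm (c 1) x (c' t)) as T2. rewrite (metric_sym Hm (c 1) x), E, E1 in T2.
    apply (Rmult_le_reg_r (2 * 1 * t)); [lra|].
    rewrite Rdiv_mult_cancel by lra.
    set (D := d (c 1) (c' t)) in *. 
    assert ((t - D) * (t - D) <= 1) by nra. unfold Rsqr. nra. }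
  lra.
Qed.

(* First variation formula, as an upper bound: the comparison angles at
   parameters [t = eps * t'] control the increment of [eta] along [c]. *)
Lemma busemann_increment_of_angle eta x c c' a eps : convex_lip d eta ->
  geod_ray d x c -> ray_to d x0 x eta c' ->
  alexandrov_angle d c c' < a -> 0 <= a <= PI -> 0 < eps <= / 2 ->
  exists t, 0 < t /\ eta (c t) - eta x <= t * (- cos a + eps / 2).
Proof.
  intros Ceta Rc Rc' Hlt Ha Heps.
  destruct (alexandrov_angle_lt Hlt) as [e [He H]].
  set (t' := e / 2). set (t := eps * t').
  assert (Ht' : 0 < t' < e) by (unfold t'; lra).
  assert (Ht : 0 < t < e) by (unfold t; nra).
  exists t. split; [lra|].
  specialize (H t t' Ht Ht'). rewrite (proj1 Rc) in H.
  destruct (geod_ray_geodesic (t:=t') (proj1 Rc') ltac:(lra)) as [E _].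
  destruct (geod_ray_geodesic (t:=t) Rc ltac:(lra)) as [E1 _].
  apply angle_le_cos in H; [|apply comparison_angle_bound|auto].
  rewrite comparison_angle_cos in H by lra. rewrite E, E1 in H.
  pose proof (COS_bound a) as Hcos.
  set (k := cos a) in *. set (D := d (c t) (c' t')) in *.
  assert (HD : 2 * t * t' * k <= t² + t'² - D²).
  { apply (Rmult_le_compat_r (2 * t * t')) in H; [|nra].
    rewrite Rdiv_mult_cancel in H by nra. lra. }
  pose proof (proj1 Ceta (c t) (c' t')) as L. fold D in L.
  rewrite (ray_to_value (t:=t') Rc') in L by lra.
  assert (D <= t' - t * k + t * (eps / 2)); [|lra].
  assert (0 <= t' - t * k) 
    by (replace (t' - t * k) with (t' * (1 - eps * k)) by (unfold t; ring); apply Rmult_le_pos; nra).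
  apply Rsqr_le_inv_nonneg; [|nra].
  (* Thanks to this identity the square of the right-hand side is
     [t'² - 2 t t' k + t² + t² (eps / 2 - k)²], which dominates the bound [HD] on [D²]. *)
  assert (Et : t * t' * eps = t * t) by (unfold t; ring).
  pose proof (Rle_0_sqr (eps / 2 - k)) as Z.
  assert (0 <= t * t * (eps / 2 - k)²) by (apply Rmult_le_pos; nra).
  unfold Rsqr in *. nra.
Qed.

(** The angle at [c0 t] between the rest of the ray and the ray to [eta] is at most [a], so the
    first variation bounds the increment of [eta] just after [c0 t]. By convexity and [eta x0 = 0],
    the average slope over [[0, t]] is no larger than that later slope. *)
Lemma slope_of_tits_le xi eta u v c0 a t : horo d x0 xi u -> horo d x0 eta v ->
  ray_to d x0 x0 xi c0 -> 0 <= a <= PI ->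
  tits_angle d x0 xi eta <= a -> 0 <= t -> eta (c0 t) <= t * - cos a.
Proof.
  intros Hxi Heta R0 Ha Htits Ht.
  pose proof (horo_convex_lip Hm Hc Hxi) as Cxi.
  pose proof (horo_convex_lip Hm Hc Heta) as Ceta.
  destruct (geod_ray_geodesic (proj1 R0) Ht) as [E _].
  (* [PI] has no strictly larger angle to feed to the first variation; there the claim is the
     Lipschitz bound. *)
  destruct (Req_dec a PI) as [->|Hpi].
  { rewrite cos_PI. pose proof (proj1 Ceta (c0 t) x0) as L.
    rewrite (horo_base Heta), (metric_sym Hm), E in L. lra. }
  apply le_of_le_add_eps. intros e He.
  set (eps := Rmin (/ 2) (e / (2 * (t + 1)))).
  assert (He' : 0 < e / (2 * (t + 1))) by (apply Rdiv_lt_0_compat; lra).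
  assert (Heps : 0 < eps <= / 2) by (split; [apply Rmin_pos; lra | apply Rmin_l]).
  assert (Hte : t * eps <= e / 2).
  { apply Rle_trans with (t * (e / (2 * (t + 1)))).
    - apply Rmult_le_compat_l; auto. apply Rmin_r.
    - assert (e / 2 = (t + 1) * (e / (2 * (t + 1)))) by (field; lra). nra. }
  pose proof (COS_bound a) as Hcos.
  assert (Hcos2 : -1 < cos a) by (rewrite <- cos_PI; apply cos_decreasing_1; lra).
  (* Truncation at [-1] keeps [acos k] a genuine angle, still strictly larger than [a]. *)
  set (k := Rmax (-1) (cos a - eps)).
  assert (Hk1 : -1 <= k) by apply Rmax_l.
  assert (Hk2 : cos a - eps <= k) by apply Rmax_r.
  assert (Hk3 : k < cos a) by (apply Rmax_lub_lt; lra).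
  assert (Ek : cos (acos k) = k) by (apply cos_acos; lra).
  pose proof (acos_bound k) as Hb.
  assert (Hak : a < acos k).
  { apply Rnot_le_lt. intros Hle. apply angle_le_cos in Hle; auto. lra. }
  destruct (horo_ray_exists Hm Hc Hp (c0 t) Heta) as [c' Rc'].
  pose proof (ray_to_shift R0 Ht) as Rs.
  pose proof (alexandrov_le_tits Rs Rc') as Hal.
  destruct (busemann_increment_of_angle Ceta (proj1 Rs) Rc' (a := acos k)
     (eps := eps) ltac:(lra) Hb Heps) as [s [Hs Hinc]]. rewrite Ek in Hinc.
  pose proof (convex_lip_ray (s:=t) (t:=t + s) Ceta (proj1 R0) ltac:(lra)) as Hcv.
  rewrite (horo_base Heta) in Hcv.
  assert (s * eta (c0 t) <= s * (t * (- k + eps / 2))) by nra.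
  apply Rmult_le_reg_l in H; [|auto].
  nra.
Qed.

End Angles.

Lemma INR_eventually_gt r : exists N, forall n, (N <= n)%nat -> r < INR n.
Proof.
  destruct (INR_archimed 1 r ltac:(lra)) as [N HN]. exists N. intros n Hn.
  apply le_INR in Hn. lra.
Qed.

(** * Circumradius and circumcenter *)

Section Boundary.
Variable T : Type.
Variable d : T -> T -> R.
Hypothesis Hm : is_metric d.
Variable x0 : T.

Lemma delta_lt_pointwise f g e y : delta_lt d x0 f g e -> d x0 y < / e -> Rabs (f y - g y) < e.
Proof.
  intros (e' & He' & h & Hh & H) Hy. eapply Rle_lt_trans; [apply H|lra].
  eapply Rlt_trans; [exact Hy|]. apply Rinv_lt_contravar; nra.
Qed.

Lemma iota_lipschitz x y z : iota d x0 x y - iota d x0 x z <= d y z.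
Proof.
  unfold iota. pose proof (metric_tri Hm x z y). rewrite (metric_sym Hm z y) in H. lra.
Qed.

Lemma iota_bound x y : Rabs (iota d x0 x y) <= d x0 y.
Proof.
  unfold iota. pose proof (metric_tri Hm x x0 y). pose proof (metric_tri Hm x y x0).
  rewrite (metric_sym Hm y x0) in H0. unfold Rabs. destruct (Rcase_abs _); lra.
Qed.

Lemma iota_perturb x z y : Rabs (iota d x0 x y - iota d x0 z y) <= 2 * d x z.
Proof.
  unfold iota. pose proof (metric_tri Hm x z y). pose proof (metric_tri Hm z x y).
  pose proof (metric_tri Hm x z x0). pose proof (metric_tri Hm z x x0).
  rewrite (metric_sym Hm z x) in *. unfold Rabs. destruct (Rcase_abs _); lra.
Qed.

Lemma dense_pointwise (a : nat -> T -> R) f y e :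
  (forall e, 0 < e -> exists n, delta_lt d x0 (a n) f e) -> 0 < e ->
  exists n, Rabs (a n y - f y) < e.
Proof.
  intros H He. destruct (eps_inv_gt (d x0 y) He) as [e' [He' Hy]].
  destruct (H e' ltac:(lra)) as [n Hn]. exists n.
  pose proof (delta_lt_pointwise Hn Hy). lra.
Qed.

Hypothesis Hc : CAT0 d.
Hypothesis Hp : proper d.

(** If the approximating points returned infinitely often to a fixed ball, properness would give
    them a cluster point [l] and [f] would equal [iota l], which [bdry] excludes. *)
Lemma bdry_horo f : bdry d x0 f -> exists u, horo d x0 f u.
Proof.
  intros [H1 H2].
  assert (Hu : forall n : nat, exists x, delta_lt d x0 (iota d x0 x) f (/ INR (S n))).
  { intros n. apply H1. apply Rinv_0_lt_compat. apply lt_0_INR. lia. }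
  apply choice in Hu. destruct Hu as [u Hu].
  assert (Hcv : forall y, Un_cv (fun n => iota d x0 (u n) y) (f y)).
  { intros y e He. destruct (INR_eventually_gt (d x0 y + / e)) as [N HN].
    exists N. intros n Hn. specialize (HN (S n) ltac:(lia)).
    assert (0 < / e) by (apply Rinv_0_lt_compat; auto).
    pose proof (metric_pos Hm x0 y).
    unfold Rdist. eapply Rlt_trans.
    - apply (delta_lt_pointwise (y:=y) (Hu n)). rewrite Rinv_inv. lra.
    - rewrite <- (Rinv_inv e). apply Rinv_lt_contravar; [apply Rmult_lt_0_compat|]; lra. }
  exists u. split; auto.
  intros r. apply NNPP. intros Hn. apply H2.
  assert (Hb : forall N, exists n, (N <= n)%nat /\ d x0 (u n) <= r).
  { intros N. apply NNPP. intros Hnn. apply Hn. exists N. intros n HNn.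
    apply Rnot_le_lt. intros Hle. apply Hnn. exists n. auto. }
  apply choice in Hb. destruct Hb as [k Hk].
  destruct (Hp (x:=x0) (r:=r) (fun n => u (k n))) as [phi [l [Hphi Hl]]]; [apply Hk|].
  pose proof (strict_mono_ge_id _ Hphi) as Hid.
  exists l. intros y.
  eapply UL_sequence.
  - apply (Un_cv_subseq (u := fun n => iota d x0 (u n) y) (fun n => k (phi n))); [|apply Hcv].
    intros n. specialize (Hid n). pose proof (proj1 (Hk (phi n))). lia.
  - intros e He. destruct (Hl (e / 2) ltac:(lra)) as [N HN]. exists N. intros n Hnn.
    specialize (HN n Hnn). pose proof (iota_perturb (u (k (phi n))) l y). unfold Rdist. lra.
Qed.

(** Pointwise convergence of 1-Lipschitz functions is uniform on compact balls. The limit is no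
    [iota x], because it tends to minus infinity along a ray whereas [iota x >= - d x x0]. *)
Lemma horo_bdry f u : horo d x0 f u -> bdry d x0 f.
Proof.
  intros Hh. pose proof (horo_convex_lip Hm Hc Hh) as Hcl. split.
  - intros e He. apply NNPP. intros Hn.
    set (r := / (e / 2)).
    assert (Hb : forall n, exists y, d x0 y <= r /\ e / 4 < Rabs (iota d x0 (u n) y - f y)).
    { intros n. apply NNPP. intros Hnn. apply Hn. exists (u n).
      exists (e/2). split; [lra|]. exists (e/4). split; [lra|].
      intros y Hy. apply Rnot_lt_le. intros Hlt. apply Hnn. exists y. split; [left; exact Hy|exact Hlt]. }
    apply choice in Hb. destruct Hb as [y Hy].
    destruct (Hp (x:=x0) (r:=r) y) as [phi [l [Hphi Hl]]]; [apply Hy|].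
    pose proof (strict_mono_ge_id _ Hphi) as Hid.
    destruct (Hl (e / 16) ltac:(lra)) as [N1 HN1].
    destruct (Un_cv_near (e := e / 16) (proj2 Hh l) ltac:(lra)) as [N2 HN2].
    set (n := (N1 + N2)%nat). specialize (HN1 n ltac:(lia)).
    specialize (Hid n). specialize (HN2 (phi n) ltac:(lia)).
    destruct (Hy (phi n)) as [_ Hbad].
    pose proof (iota_lipschitz (u (phi n)) (y (phi n)) l).
    pose proof (iota_lipschitz (u (phi n)) l (y (phi n))).
    pose proof (proj1 Hcl (y (phi n)) l). pose proof (proj1 Hcl l (y (phi n))).
    rewrite (metric_sym Hm l) in *.
    unfold Rabs in Hbad. destruct (Rcase_abs _); lra.
  - intros [x Hx]. destruct (horo_ray_exists Hm Hc Hp x0 Hh) as [c Rc].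
    set (t := d x x0 + 1). pose proof (metric_pos Hm x x0).
    pose proof (ray_to_value (t:=t) Rc ltac:(unfold t; lra)) as E.
    rewrite (horo_base Hh), Hx in E. unfold iota in E.
    pose proof (metric_pos Hm x (c t)). unfold t in *. lra.
Qed.

Variable q : nat -> T.
Hypothesis Hq : forall x e, 0 < e -> exists n, d (q n) x < e.

(** Arzelà-Ascoli: the functions [iota (u n)] are 1-Lipschitz and bounded at each point, so a
    diagonal subsequence converging on the dense family [q] converges everywhere. *)
Lemma horo_compactness (u : nat -> T) :
  (forall r, exists N, forall n, (N <= n)%nat -> r < d x0 (u n)) ->
  exists theta f, (forall n, (n <= theta n)%nat) /\ horo d x0 f (fun n => u (theta n)).
Proof.
  intros Hu.
  destruct (@diagonal_subseq (fun k n => iota d x0 (u n) (q k)) (fun k => d x0 (q k)))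
    as [theta [Hth Hcv]].
  { intros k n. apply iota_bound. }
  assert (Hf : forall y, exists l, Un_cv (fun n => iota d x0 (u (theta n)) y) l).
  { intros y. apply Cauchy_exists_limit. intros e He.
    destruct (Hq y (e:=e/8) ltac:(lra)) as [k Hk]. destruct (Hcv k) as [l Hl].
    destruct (Un_cv_near (e := e / 8) Hl ltac:(lra)) as [N HN].
    exists N. intros n m Hn Hmm. unfold Rdist.
    pose proof (HN n Hn). pose proof (HN m Hmm).
    pose proof (iota_lipschitz (u (theta n)) (q k) y).
    pose proof (iota_lipschitz (u (theta n)) y (q k)).
    pose proof (iota_lipschitz (u (theta m)) (q k) y).
    pose proof (iota_lipschitz (u (theta m)) y (q k)).
    rewrite (metric_sym Hm y) in *. apply Rabs_def1; lra. }
  apply choice in Hf. destruct Hf as [f Hf].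
  exists theta, f. split; auto. split; auto.
  intros r. destruct (Hu r) as [N HN]. exists N. intros n Hn. apply HN. specialize (Hth n). lia.
Qed.

Variable A : (T -> R) -> Prop.
Hypothesis HA : forall f, A f -> bdry d x0 f.
Hypothesis HAne : exists f, A f.

Lemma bdry_convex_lip f : bdry d x0 f -> convex_lip d f /\ f x0 = 0.
Proof.
  intros H. destruct (bdry_horo H) as [u Hu].
  split; [eapply horo_convex_lip | eapply horo_base]; eauto.
Qed.

(* For [C = cos a]: [A] lies in the closed Tits ball of radius [a] around [xi]. *)
Definition centered (C : R) (xi : T -> R) : Prop :=
  bdry d x0 xi /\ forall c eta t, ray_to d x0 x0 xi c -> A eta -> 0 <= t -> eta (c t) <= t * - C.

(** The ray to the limit [xi] consists of limits of points on geodesics from [x0] to the [y n].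
    Convexity of [eta] with [eta x0 = 0] scales the descent at [y n] down to parameter [t], where
    the slack contributes [2 * t / d x0 (y n)] and vanishes. *)
Lemma centered_of_descent (y : nat -> T) C :
  (forall r, exists N, forall n, (N <= n)%nat -> r < d x0 (y n)) ->
  (forall n eta, A eta -> eta (y n) <= - C * d x0 (y n) + 2) ->
  exists theta xi, (forall n, (n <= theta n)%nat) /\
    horo d x0 xi (fun n => y (theta n)) /\ centered C xi.
Proof.
  intros Hy Hd. destruct (horo_compactness _ Hy) as (theta & xi & Hth & Hh).
  exists theta, xi. split; auto. split; auto. split; [eapply horo_bdry; eauto|].
  intros c eta t Rc Heta Ht.
  destruct (bdry_convex_lip (HA Heta)) as [Ceta E0].
  pose proof (horo_convex_lip Hm Hc Hh) as Cxi.
  destruct (radial_limit_exists Hm Hc Hp x0 Hh Ht) as [p [Ep Lp]].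
  pose proof (radial_limit_value Hm Hc Hh Ht Ep Lp) as Vp.
  assert (E : c t = p).
  { apply (@descent_point_unique T d Hm Hc xi x0 t); auto; try lra.
    - destruct (geod_ray_geodesic (proj1 Rc) Ht). lra.
    - rewrite (ray_to_value Rc Ht). lra. }
  rewrite E. apply le_of_le_add_eps. intros e He.
  destruct (horo_far Hm x0 (4 * t / e) Hh) as [N HN].
  destruct (Lp (e/2) N ltac:(lra)) as (n & g & Hn & Hg & Hle & Hlt).
  specialize (HN n Hn). specialize (Hd (theta n) eta Heta).
  pose proof (proj2 Ceta _ _ _ t Hg ltac:(lra)) as K. rewrite E0 in K.
  pose proof (proj1 Ceta p (g t)) as L. rewrite (metric_sym Hm p) in L.
  set (a := d x0 (y (theta n))) in *.
  assert (0 <= 4 * t / e) by (apply Rmult_le_pos; [lra|left; apply Rinv_0_lt_compat; auto]).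
  assert (4 * t = e * (4 * t / e)) by (field; lra).
  assert (2 * t <= a * (e / 2)) by nra.
  assert (eta (g t) <= t * - C + e / 2); [|lra].
  apply (Rmult_le_reg_l a); [lra|]. nra.
Qed.

Definition tits_radius (xi : T -> R) : R :=
  Rsup (fun b => exists eta, A eta /\ b = tits_angle d x0 xi eta).

Lemma tits_radius_le_iff xi a : bdry d x0 xi -> 0 <= a <= PI ->
  (tits_radius xi <= a <-> centered (cos a) xi).
Proof.
  intros Hxi Ha. destruct (bdry_horo Hxi) as [u Hu]. split.
  - intros H. split; auto. intros c eta t Rc Heta Ht.
    destruct (bdry_horo (HA Heta)) as [v Hv].
    apply (slope_of_tits_le Hm Hc Hp Hu Hv Rc Ha); auto.
    eapply Rle_trans; [|exact H]. apply Rsup_ub with PI; [|eauto].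
    intros b (eta' & Heta' & ->). destruct (bdry_horo (HA Heta')) as [v' Hv'].
    eapply (tits_angle_bound Hm Hc Hp); eauto.
  - intros [_ H]. apply Rsup_le.
    + destruct HAne as [eta Heta]. eauto.
    + intros b (eta & Heta & ->). destruct (bdry_horo (HA Heta)) as [v Hv].
      destruct (horo_ray_exists Hm Hc Hp x0 Hu) as [c Rc].
      apply (tits_le_of_slope Hm Hc Hp Hu Hv Rc Ha). eauto.
Qed.

Lemma tits_radius_bound xi : bdry d x0 xi -> 0 <= tits_radius xi <= PI.
Proof.
  intros Hxi. destruct (bdry_horo Hxi) as [u Hu].
  assert (HB : forall b, (exists eta, A eta /\ b = tits_angle d x0 xi eta) -> 0 <= b <= PI).
  { intros b (eta & Heta & ->). destruct (bdry_horo (HA Heta)) as [v Hv].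
    eapply (tits_angle_bound Hm Hc Hp); eauto. }
  destruct HAne as [eta Heta]. split.
  - eapply Rle_trans; [|apply Rsup_ub with PI; [intros; apply HB; eauto | exists eta; split; eauto]].
    apply HB. eauto.
  - apply Rsup_le; eauto. intros b Hb. apply HB. exact Hb.
Qed.

Lemma circumradius_le_tits_radius xi : bdry d x0 xi -> circumradius d x0 A <= tits_radius xi.
Proof.
  intros Hxi. apply Rinf_lb with 0.
  - intros y (xi' & Hxi' & ->). apply (tits_radius_bound Hxi').
  - exists xi. auto.
Qed.

Lemma circumradius_bound : 0 <= circumradius d x0 A <= PI.
Proof.
  destruct HAne as [f Hf]. split.
  - apply Rinf_ge.
    + eexists. exists f. split; [auto|reflexivity].
    + intros y (xi & Hxi & ->). apply (tits_radius_bound Hxi).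
  - eapply Rle_trans; [apply (circumradius_le_tits_radius (HA Hf))|]. apply (tits_radius_bound (HA Hf)).
Qed.

Lemma circumradius_le_of_centered a xi : 0 <= a <= PI -> centered (cos a) xi ->
  circumradius d x0 A <= a.
Proof.
  intros Ha H. eapply Rle_trans; [apply (circumradius_le_tits_radius (proj1 H))|].
  apply tits_radius_le_iff; auto. apply H.
Qed.

(** Some [xi] beats an angle slightly above the infimum [r], expressed here by cosines. For [r = PI]
    no such angle exists, but any point of [A] serves since cosines are at least [-1]. *)
Lemma circumradius_approx e : 0 < e -> exists xi C,
  cos (circumradius d x0 A) - e <= C /\ centered C xi.
Proof.
  intros He. pose proof circumradius_bound as Hr. set (r := circumradius d x0 A) in *.
  destruct (Req_dec r PI) as [Er|Er].
  - destruct HAne as [f Hf]. exists f, (cos (tits_radius f)).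
    pose proof (tits_radius_bound (HA Hf)). rewrite Er, cos_PI. pose proof (COS_bound (tits_radius f)).
    split; [lra|]. apply tits_radius_le_iff; auto. lra.
  - assert (Hcos2 : -1 < cos r) by (rewrite <- cos_PI; apply cos_decreasing_1; lra).
    pose proof (COS_bound r) as Hcos.
    set (k := Rmax (-1) (cos r - e)).
    assert (Hk1 : -1 <= k) by apply Rmax_l.
    assert (Hk2 : cos r - e <= k) by apply Rmax_r.
    assert (Hk3 : k < cos r) by (apply Rmax_lub_lt; lra).
    assert (Ek : cos (acos k) = k) by (apply cos_acos; lra).
    pose proof (acos_bound k) as Hb.
    assert (Hak : r < acos k).
    { apply Rnot_le_lt. intros Hle. apply angle_le_cos in Hle; auto. lra. }
    apply Rinf_lt_witness in Hak.
    + destruct Hak as [y [(xi & Hxi & ->) Hlt]]. fold (tits_radius xi) in Hlt.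
      exists xi, k. split; auto. rewrite <- Ek. apply tits_radius_le_iff; auto. lra.
    + destruct HAne as [f Hf]. eexists. exists f. split; [auto|reflexivity].
Qed.

(** The additive slack 2 lets [y] range over a countable dense family and lets near-optimal rays
    replace optimal ones. *)
Definition admissible (C : R) (n : nat) (y : T) : Prop :=
  INR n <= d x0 y /\ forall eta, A eta -> eta y <= - C * d x0 y + 2.

Lemma admissible_exists n C : -1 <= C <= cos (circumradius d x0 A) ->
  exists m, admissible C n (q m).
Proof.
  intros HC. pose proof (COS_bound (circumradius d x0 A)) as Hcos.
  set (t := INR n + 1). pose proof (pos_INR n) as Hn.
  assert (Ht : 0 < t) by (unfold t; lra).
  (* The slack 2 is spent as follows: 1/2 for [eta] between [q m] and [c t], 1 for the error [/ t]
     in [C'] over length [t], and 1/2 for replacing [t] by [d x0 (q m)]. *)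
  destruct (@circumradius_approx (/ t)) as (xi & C' & HC' & Hxi & Hg).
  { apply Rinv_0_lt_compat. auto. }
  destruct (bdry_horo Hxi) as [u Hu].
  destruct (horo_ray_exists Hm Hc Hp x0 Hu) as [c Rc].
  destruct (Hq (c t) (e:=/2) ltac:(lra)) as [m Hm'].
  exists m. destruct (geod_ray_geodesic (t:=t) (proj1 Rc) ltac:(lra)) as [E _].
  pose proof (metric_tri Hm x0 (q m) (c t)) as T1.
  pose proof (metric_tri Hm x0 (c t) (q m)) as T2.
  rewrite (metric_sym Hm (c t)) in T2. rewrite E in *.
  split; [unfold t in *; lra|].
  intros eta Heta. destruct (bdry_convex_lip (HA Heta)) as [[L _] _].
  specialize (L (q m) (c t)). specialize (Hg c eta t Rc Heta ltac:(lra)).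
  assert (t * / t = 1) by (field; lra).
  assert (t * C <= t * C' + 1) by nra.
  assert (C * (d x0 (q m) - t) <= / 2); [|lra].
  assert (- / 2 <= d x0 (q m) - t <= / 2) by lra. nra.
Qed.

Lemma INR_le_far (y : nat -> T) (k : nat -> nat) : (forall n, (n <= k n)%nat) ->
  (forall n, INR (k n) <= d x0 (y n)) ->
  forall r, exists N, forall n, (N <= n)%nat -> r < d x0 (y n).
Proof.
  intros Hk H r. destruct (INR_eventually_gt r) as [N HN]. exists N. intros n Hn.
  eapply Rlt_le_trans; [|apply H]. apply HN. specialize (Hk n). lia.
Qed.

Lemma circumradius_le_iff a : 0 <= a <= PI ->
  (circumradius d x0 A <= a <-> forall n, exists m, admissible (cos a) n (q m)).
Proof.
  intros Ha. pose proof circumradius_bound as Hr. split.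
  - intros H n. apply admissible_exists. apply angle_le_cos in H; auto.
    pose proof (COS_bound a). lra.
  - intros H. apply choice in H. destruct H as [m Hmm].
    destruct (@centered_of_descent (fun n => q (m n)) (cos a)) as (th & xi & _ & _ & Hcen).
    + apply INR_le_far with (k := fun n => n); [lia|]. intros n. apply Hmm.
    + intros n eta Heta. apply Hmm; auto.
    + apply (circumradius_le_of_centered Ha Hcen).
Qed.

(* If two centres existed, the midpoints of their rays would be strictly closer
   to [x0] at the same height, hence descend at a speed exceeding the optimum. *)
Lemma centered_unique xi xi' y : circumradius d x0 A < PI / 2 ->
  centered (cos (circumradius d x0 A)) xi -> centered (cos (circumradius d x0 A)) xi' ->
  xi y = xi' y.
Proof.
  intros Hlt H H'. pose proof circumradius_bound as Hr.
  assert (HC : 0 < cos (circumradius d x0 A)) by (apply cos_gt_0; lra).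
  pose proof (COS_bound (circumradius d x0 A)) as Hcos.
  set (C := cos (circumradius d x0 A)) in *.
  destruct H as [Hxi Hg]. destruct H' as [Hxi' Hg'].
  destruct (bdry_horo Hxi) as [u Hu]. destruct (bdry_horo Hxi') as [u' Hu'].
  destruct (horo_ray_exists Hm Hc Hp x0 Hu) as [c Rc].
  destruct (horo_ray_exists Hm Hc Hp x0 Hu') as [c' Rc'].
  assert (Heq : forall t, 0 <= t -> c t = c' t).
  { intros t0 Ht0. apply NNPP. intros Hne.
    assert (HD0 : 0 < d (c t0) (c' t0)).
    { destruct (metric_pos Hm (c t0) (c' t0)); auto. exfalso. apply Hne.
      apply (metric_eq0 Hm). auto. }
    set (D0 := d (c t0) (c' t0)) in *.
    assert (Ht0' : 0 < t0).
    { destruct Ht0 as [|<-]; auto. exfalso. apply Hne.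
      rewrite (proj1 (proj1 Rc)), (proj1 (proj1 Rc')). auto. }
    (* The CAT(0) inequality makes [d (c t) (c' t) / t] nondecreasing, so the rays are at least
       [s * t] apart for [t >= t0]; the CN inequality then gives the factor [1 - s² / 4]. *)
    set (s := D0 / t0).
    assert (Hs : 0 < s) by (apply Rdiv_lt_0_compat; auto).
    assert (Hmid : forall n, exists m, 
       (d x0 m)² <= (t0 + INR n)² * (1 - s² / 4) /\
       forall eta, A eta -> eta m <= (t0 + INR n) * - C).
    { intros n. pose proof (pos_INR n). set (t := t0 + INR n) in *.
      assert (Ht : t0 <= t) by (unfold t; lra).
      destruct (geod_ray_geodesic (proj1 Rc) (t:=t) ltac:(lra)) as [E G].
      destruct (geod_ray_geodesic (proj1 Rc') (t:=t) ltac:(lra)) as [E' G'].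
      pose proof (proj2 Hc _ _ _ _ _ G G' ltac:(lra) ltac:(lra) t0 t0 ltac:(lra) ltac:(lra)) as K.
      rewrite E, E' in K. fold D0 in K.
      destruct (CN_midpoint Hm Hc (c t) (c' t)) as (g & Hgg & _ & Hcn).
      specialize (Hcn x0). pose proof (fun f Hf => @convex_lip_mid _ d Hm f _ _ _ Hf Hgg) as Hmd.
      set (m := g (d (c t) (c' t) / 2)) in *. set (D := d (c t) (c' t)) in *.
      exists m. split.
      - rewrite (metric_sym Hm (c t)), (metric_sym Hm (c' t)), E, E' in Hcn.
        rewrite (metric_sym Hm x0).
        assert (s² * t² <= D²).
        { replace (t0² + t0² - t0 * t0 * (t² + t² - D²) / (t * t)) with (t0² * D² / t²) in K
            by (unfold Rsqr; field; lra).
          replace (s² * t²) with (D0² * (t² / t0²)) by (unfold s, Rsqr; field; lra).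
          replace (D²) with (t0² * D² / t² * (t² / t0²)) by (unfold Rsqr; field; lra).
          apply Rmult_le_compat_r; auto.
          apply Rmult_le_pos; [apply Rle_0_sqr|]. left. apply Rinv_0_lt_compat.
          apply Rlt_0_sqr. lra. }
        lra.
      - intros eta Heta. specialize (Hmd eta (proj1 (bdry_convex_lip (HA Heta)))).
        pose proof (Hg c eta t Rc Heta ltac:(lra)). pose proof (Hg' c' eta t Rc' Heta ltac:(lra)).
        lra. }
    apply choice in Hmid. destruct Hmid as [m Hmm].
    (* Descending by [C * t] requires travelling that far, so the midpoints leave every ball; it
       also forces [C² <= ka]. *)
    assert (Hlow : forall n, C * (t0 + INR n) <= d x0 (m n)).
    { intros n. destruct HAne as [eta Heta]. destruct (Hmm n) as [_ K]. specialize (K eta Heta).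
      destruct (bdry_convex_lip (HA Heta)) as [[L _] E0]. specialize (L x0 (m n)). lra. }
    set (ka := 1 - s² / 4) in *.
    assert (Hka : C² <= ka).
    { destruct (Hmm O) as [K _]. specialize (Hlow O). simpl INR in *.
      rewrite Rplus_0_r in *. apply (Rmult_le_reg_r (t0²)); [apply Rlt_0_sqr; lra|].
      rewrite (Rmult_comm ka). eapply Rle_trans; [|exact K].
      rewrite <- Rsqr_mult. apply Rsqr_incr_1; auto; [nra|apply (metric_pos Hm)]. }
    assert (HC2 : 0 < C²) by (apply Rlt_0_sqr; lra).
    assert (Hs2 : 0 < s²) by (apply Rlt_0_sqr; lra).
    set (k := sqrt ka).
    assert (Hk : k² = ka) by (apply Rsqr_sqrt; lra).
    assert (Hk0 : 0 < k) by (apply sqrt_lt_R0; lra).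
    assert (Hk1 : k < 1) by (apply Rsqr_incrst_0; rewrite ?Rsqr_1; unfold ka in *; lra).
    assert (HCk : C <= k) by (apply Rsqr_le_inv_nonneg; lra).
    (* The midpoints descend by [C * t] within distance [k * t], hence at speed [C / k > C]. The
       bound [C <= k] makes [acos C'] an angle, which is then a radius below the circumradius. *)
    set (C' := C / k).
    assert (EC : C' * k = C) by (unfold C'; field; lra).
    assert (HC' : C < C') by nra.
    assert (HC'1 : C' <= 1) by nra.
    destruct (@centered_of_descent m C') as (th & xi'' & _ & _ & Hcen).
    - intros r. destruct (INR_eventually_gt (r / C)) as [N HN]. exists N. intros n Hn.
      specialize (HN n Hn). specialize (Hlow n).
      assert (r = C * (r / C)) by (field; lra). nra.
    - intros n eta Heta. destruct (Hmm n) as [K1 K2]. specialize (K2 eta Heta).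
      pose proof (pos_INR n). set (t := t0 + INR n) in *.
      assert (d x0 (m n) <= t * k).
      { apply Rsqr_le_inv_nonneg; [|unfold t; nra]. rewrite Rsqr_mult, Hk. exact K1. }
      assert (C' * d x0 (m n) <= C * t); [|lra]. rewrite <- EC.
      replace (C' * k * t) with (C' * (t * k)) by ring. apply Rmult_le_compat_l; lra.
    - assert (Ea : cos (acos C') = C') by (apply cos_acos; lra).
      pose proof (acos_bound C') as Hb. rewrite <- Ea in Hcen.
      pose proof (circumradius_le_of_centered Hb Hcen) as Z.
      apply angle_le_cos in Z; auto. fold C in Z. lra. }
  (* Both functions are recovered as the Busemann limit along the common ray. *)
  apply Rle_antisym; apply le_of_le_add_eps; intros e He;
    destruct (proj2 Rc y (e/2) ltac:(lra)) as [t1 B1];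
    destruct (proj2 Rc' y (e/2) ltac:(lra)) as [t2 B2];
    pose proof (Rmax_l 0 (Rmax t1 t2)); pose proof (Rmax_r 0 (Rmax t1 t2));
    pose proof (Rmax_l t1 t2); pose proof (Rmax_r t1 t2);
    set (t := Rmax 0 (Rmax t1 t2)) in *;
    specialize (B1 t ltac:(lra)); specialize (B2 t ltac:(lra));
    rewrite <- (Heq t ltac:(lra)) in B2; apply Rabs_def2 in B1, B2; lra.
Qed.

Lemma circumcenter_centered c : is_circumcenter d x0 A c ->
  centered (cos (circumradius d x0 A)) c.
Proof.
  intros [H1 H2]. apply tits_radius_le_iff; auto; [apply circumradius_bound|].
  unfold tits_radius. rewrite H2. lra.
Qed.

(** By uniqueness of the centre, any sequence of admissible points with [n] tending to infinity has
    a subsequence along which [iota] converges to [c]. So a sublevel condition on [c x] can be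
    tested on the countable family [q], with tolerance [/ INR (S j)]. *)
Lemma circumcenter_le_iff c x z : circumradius d x0 A < PI / 2 -> is_circumcenter d x0 A c ->
  (c x <= z <-> forall j, exists n m, (j <= n)%nat /\
     admissible (cos (circumradius d x0 A)) n (q m) /\
     iota d x0 (q m) x <= z + / INR (S j)).
Proof.
  intros Hlt Hcc. pose proof (circumcenter_centered Hcc) as Hcen.
  pose proof (COS_bound (circumradius d x0 A)) as Hcos.
  set (C := cos (circumradius d x0 A)) in *.
  assert (Hlim : forall (m n : nat -> nat), (forall j, (j <= n j)%nat) ->
     (forall j, admissible C (n j) (q (m j))) ->
     exists th, (forall j, (j <= th j)%nat) /\
       Un_cv (fun j => iota d x0 (q (m (th j))) x) (c x)).
  { intros m n Hn Hadm.
    destruct (@centered_of_descent (fun j => q (m j)) C) as (th & xi & Hth & Hh & Hxi).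
    - apply INR_le_far with (k := n); auto. intros j. apply Hadm.
    - intros j eta Heta. apply Hadm; auto.
    - exists th. split; auto. rewrite (centered_unique x Hlt Hcen Hxi). apply Hh. }
  split.
  - intros Hle j. apply NNPP. intros Hno.
    assert (Hall : forall i, exists m, admissible C (j + i)%nat (q m)).
    { intros i. apply admissible_exists. fold C. lra. }
    apply choice in Hall. destruct Hall as [m Hadm].
    destruct (Hlim m (fun i => (j + i)%nat)) as [th [Hth Hcv]]; auto; [lia|].
    assert (Hj : 0 < / INR (S j)) by (apply Rinv_0_lt_compat; apply lt_0_INR; lia).
    destruct (Un_cv_near Hcv Hj) as [N HN]. specialize (HN N ltac:(lia)).
    apply Hno. exists (j + th N)%nat, (m (th N)). split; [lia|]. split; auto. lra.
  - intros H. apply choice in H. destruct H as [n H]. apply choice in H. destruct H as [m H].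
    destruct (Hlim m n) as [th [Hth Hcv]]; [apply H|apply H|].
    apply le_of_le_add_eps. intros e He.
    apply (Un_cv_frequently_le Hcv).
    destruct (archimed_cor1 e He) as [K [HK HK0]].
    intros N. exists (N + K)%nat. split; [lia|].
    destruct (H (th (N + K)%nat)) as (_ & _ & Hio). specialize (Hth (N + K)%nat).
    eapply Rle_trans; [exact Hio|].
    assert (/ INR (S (th (N + K)%nat)) <= / INR K); [|lra].
    apply Rinv_le_contravar; [apply lt_0_INR; lia|apply le_INR; lia].
Qed.

End Boundary.

(** Rationals are indexed by three naturals so that a quantifier over them becomes three countable
    unions. *)
Definition rational (i j n : nat) : R := (INR i - INR j) / INR (S n).

Lemma rational_dense a b : a < b -> exists i j n, a < rational i j n < b.
Proof.
  intros H. destruct (INR_archimed (b - a) 1 ltac:(lra)) as [n Hn].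
  assert (Hn1 : 0 < INR (S n)) by (apply lt_0_INR; lia).
  rewrite S_INR in Hn1.
  destruct (archimed (a * INR (S n))) as [U1 U2]. rewrite S_INR in U1, U2.
  set (k := up (a * (INR n + 1))) in *.
  (* At least one of these two truncations is 0, so their difference is the integer [k] whatever its
     sign. *)
  exists (Z.to_nat k), (Z.to_nat (- k)), n. unfold rational. rewrite S_INR.
  replace (INR (Z.to_nat k) - INR (Z.to_nat (- k))) with (IZR k).
  - split; apply (Rmult_lt_reg_r (INR n + 1)); auto; rewrite Rdiv_mult_cancel by lra; nra.
  - rewrite !INR_IZR_INZ, <- minus_IZR. f_equal. lia.
Qed.

Lemma R_open_superlevel phi a : continuity phi -> R_open (fun x => a < phi x).
Proof.
  intros Hc x Hx. destruct (Hc x (phi x - a) ltac:(lra)) as [e [He H]].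
  exists e. split; auto. intros y Hy.
  destruct (Req_dec x y) as [<-|Hne]; auto.
  specialize (H y). simpl in H. unfold Rdist in H.
  assert (HH : Rabs (phi y - phi x) < phi x - a).
  { apply H. split; [|auto]. split; [exact I|auto]. }
  apply Rabs_def2 in HH. lra.
Qed.

(** * Borel functions *)

Section Measurable.
Variable Om : Type.
Variable M : (Om -> Prop) -> Prop.
Hypothesis HM : sigma_algebra M.

Lemma sa_ext S S' : M S -> (forall w, S' w <-> S w) -> M S'.
Proof.
  intros HS H. replace S' with S; auto.
  apply functional_extensionality. intros w. symmetry. apply propositional_extensionality. auto.
Qed.

Lemma sa_forall (S : nat -> Om -> Prop) : (forall n, M (S n)) -> M (fun w => forall n, S n w).
Proof.
  intros H. eapply sa_ext.
  - apply (sa_compl HM), (sa_union HM (fun n w => ~ S n w)).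
    intros n. apply (sa_compl HM), H.
  - intros w. split.
    + intros Ha [n Hn]. apply Hn, Ha.
    + intros Hn n. apply NNPP. intros Hc. apply Hn. exists n. exact Hc.
Qed.

Lemma sa_and S1 S2 : M S1 -> M S2 -> M (fun w => S1 w /\ S2 w).
Proof.
  intros H1 H2. eapply sa_ext.
  - apply (sa_forall (fun n w => match n with O => S1 w | _ => S2 w end)). intros [|n]; auto.
  - intros w. split.
    + intros [Ha Hb] [|n]; auto.
    + intros H. split; [apply (H O)|apply (H 1%nat)].
Qed.

Lemma sa_prop (P : Prop) : M (fun _ => P).
Proof.
  destruct (classic P) as [h|h].
  - eapply sa_ext; [apply (sa_full HM)|]. tauto.
  - eapply sa_ext; [apply (sa_compl HM), (sa_full HM)|]. tauto.
Qed.

Lemma sa_exists_rational (S : R -> Om -> Prop) : (forall y, M (S y)) ->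
  M (fun w => exists i j n, S (rational i j n) w).
Proof.
  intros H. apply (sa_union HM (fun i w => exists j n, S (rational i j n) w)). intros i.
  apply (sa_union HM (fun j w => exists n, S (rational i j n) w)). intros j.
  apply (sa_union HM (fun n w => S (rational i j n) w)). auto.
Qed.

(** An open set is the union of the intervals [(p, q]] with rational ends that it contains, and
    membership of [f w] in such an interval involves sublevel sets only. Complements and unions
    follow by induction. *)
Lemma borel_fun_of_le f : (forall a, M (fun w => f w <= a)) -> borel_fun M f.
Proof.
  intros H B HB. induction HB as [U HU|B _ IH|B _ IH].
  - eapply sa_ext.
    + apply (sa_exists_rational (fun p w => exists i j n,
        (forall y, p < y <= rational i j n -> U y) /\ (~ f w <= p /\ f w <= rational i j n))).
      intros p. apply (sa_exists_rational (fun q w =>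
        (forall y, p < y <= q -> U y) /\ (~ f w <= p /\ f w <= q))). intros q.
      apply sa_and; [apply sa_prop|]. apply sa_and; [apply (sa_compl HM)|]; apply H.
    + intros w. split.
      * intros Hw. destruct (HU _ Hw) as [e [He HUe]].
        destruct (@rational_dense (f w - e) (f w) ltac:(lra)) as (i & j & n & H1).
        destruct (@rational_dense (f w) (f w + e) ltac:(lra)) as (i' & j' & n' & H2).
        exists i, j, n, i', j', n'. split; [|lra].
        intros y Hy. apply HUe. apply Rabs_def1; lra.
      * intros (i & j & n & i' & j' & n' & H1 & H2 & H3). apply H1. lra.
  - apply (sa_compl HM). exact IH.
  - apply (sa_union HM (fun n w => B n (f w))). exact IH.
Qed.

Lemma borel_superlevel f a phi : continuity phi -> borel_fun M f -> M (fun w => a < phi (f w)).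
Proof.
  intros Hc Hf. apply (Hf (fun x => a < phi x)). apply borelR_open, R_open_superlevel, Hc.
Qed.

Lemma borel_comp phi f : continuity phi -> borel_fun M f -> borel_fun M (fun w => phi (f w)).
Proof.
  intros Hc Hf. apply borel_fun_of_le. intros a. eapply sa_ext.
  - apply (sa_compl HM), (borel_superlevel a Hc Hf).
  - intros w. cbv beta. split; lra.
Qed.

Lemma borel_gt f a : borel_fun M f -> M (fun w => a < f w).
Proof. intros Hf. apply (borel_superlevel a (phi := fun x => x)); auto. reg. Qed.

Lemma borel_const a : borel_fun M (fun _ => a).
Proof. intros B _. apply sa_prop. Qed.

Lemma borel_plus f g : borel_fun M f -> borel_fun M g -> borel_fun M (fun w => f w + g w).
Proof.
  intros Hf Hg. apply borel_fun_of_le. intros a. eapply sa_ext.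
  - apply (sa_compl HM), (sa_exists_rational (fun y w => y < f w /\ a - y < g w)).
    intros y. apply sa_and; apply borel_gt; auto.
  - intros w. cbv beta. split.
    + intros H (i & j & n & H1 & H2). lra.
    + intros H. apply Rnot_lt_le. intros Hlt. apply H.
      destruct (@rational_dense (a - g w) (f w) ltac:(lra)) as (i & j & n & H1).
      exists i, j, n. lra.
Qed.

Lemma borel_opp f : borel_fun M f -> borel_fun M (fun w => - f w).
Proof. apply (borel_comp (phi := Ropp)). reg. Qed.

(* Polarization reduces products to squares, a continuous function of one variable. *)
Lemma borel_mult f g : borel_fun M f -> borel_fun M g -> borel_fun M (fun w => f w * g w).
Proof.
  intros Hf Hg.
  assert (Hs : forall h, borel_fun M h -> borel_fun M (fun w => (h w)² / 2)).
  { intros h. apply (borel_comp (phi := fun x => x² / 2)). reg. }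
  replace (fun w => f w * g w) with
    (fun w => (f w + g w)² / 2 + (- ((f w)² / 2) + - ((g w)² / 2))).
  - apply borel_plus; [apply (Hs (fun w => f w + g w)), borel_plus; auto|].
    apply borel_plus; apply borel_opp; auto.
  - apply functional_extensionality. intros w. unfold Rsqr. field.
Qed.

Lemma borel_le f g : borel_fun M f -> borel_fun M g -> M (fun w => f w <= g w).
Proof.
  intros Hf Hg. eapply sa_ext.
  - apply (sa_compl HM), (borel_gt 0 (borel_plus Hf (borel_opp Hg))).
  - intros w. cbv beta. split; lra.
Qed.

End Measurable.

Theorem mainTheorem12
  (Om : Type) (M : (Om -> Prop) -> Prop) (HM : sigma_algebra M)
  (X : Om -> Type) (d : forall w, X w -> X w -> R) (L : section X -> Prop)
  (HF : borel_field M d L)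
  (Hcat : forall w, CAT0 (d w) /\ proper (d w) /\ unbounded (d w))
  (x0 : section X) (Hx0 : L x0)
  (A : forall w, (X w -> R) -> Prop)
  (HA : borel_bdry_subfield M d L x0 A)
  (Hne : forall w, exists f, A w f)
  (Hcl : forall w, cone_closed (d w) (x0 w) (A w)) :
  borel_fun M (fun w => circumradius (d w) (x0 w) (A w)) /\
  ((forall w, circumradius (d w) (x0 w) (A w) < PI / 2) ->
   forall c : forall w, X w -> R,
     (forall w, is_circumcenter (d w) (x0 w) (A w) (c w)) ->
     borel_bdry_section M d L x0 c).
Proof.
  destruct HF as [Hm (Hd & _ & q & HqL & Hq)].
  destruct HA as [HAb (_ & a & Ha1 & Ha2 & Ha3)].
  assert (Hc : forall w, CAT0 (d w)) by apply Hcat.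
  assert (Hp : forall w, proper (d w)) by apply Hcat.
  (* Every [A w] is inhabited, so Borel on the domain of the subfield means Borel on all of [Om]. *)
  assert (Ha : forall k m, borel_fun M (fun w => a k w (q m w))).
  { intros k m B HB. eapply sa_ext; [apply (Ha2 k (q m) (HqL m) B HB)|].
    intros w. cbv beta. split; [|tauto]. intros H. split; auto. }
  (* The angle [rho] may vary with [w]: it is constant for (i) and the circumradius itself for (ii).
     The quantifier over [A w] is reduced to the dense sequence [a]. *)
  assert (Hadm : forall rho n m, borel_fun M rho ->
     M (fun w => admissible (d w) (x0 w) (A w) (cos (rho w)) n (q m w))).
  { intros rho n m Hrho.
    assert (HD : borel_fun M (fun w => d w (x0 w) (q m w))) by (apply Hd; auto).
    apply (sa_and HM); [apply (borel_le HM (borel_const HM (INR n)) HD)|].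
    eapply sa_ext.
    - apply (sa_forall HM (fun k w => a k w (q m w) <= - cos (rho w) * d w (x0 w) (q m w) + 2)).
      intros k. apply (borel_le HM (Ha k m)).
      apply (borel_plus HM); [|apply (borel_const HM)]. apply (borel_mult HM); auto.
      apply (borel_opp HM). apply (borel_comp HM); auto. apply continuity_cos.
    - intros w. cbv beta. split.
      + intros H k. apply H. apply Ha1. apply Hne.
      + intros H eta Heta. apply le_of_le_add_eps. intros e He.
        destruct (@dense_pointwise _ (d w) (x0 w) (fun k => a k w) eta (q m w) e
          (fun e' He' => Ha3 w eta e' Heta He') He) as [k Hk].
        specialize (H k). apply Rabs_def2 in Hk. lra. }
  assert (Hr : borel_fun M (fun w => circumradius (d w) (x0 w) (A w))).
  { apply (borel_fun_of_le HM). intros z.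
    assert (Hb : forall w, 0 <= circumradius (d w) (x0 w) (A w) <= PI).
    { intros w. apply circumradius_bound; auto. }
    (* Outside [[0, PI]] the cosine no longer determines the angle, but there the sublevel set is
       empty or everything. *)
    destruct (Rlt_dec z 0) as [h1|h1].
    { eapply sa_ext; [apply (sa_prop HM False)|]. intros w. specialize (Hb w). split; [lra|tauto]. }
    destruct (Rlt_dec PI z) as [h2|h2].
    { eapply sa_ext; [apply (sa_prop HM True)|]. intros w. specialize (Hb w). split; [tauto|lra]. }
    eapply sa_ext.
    - apply (sa_forall HM (fun n w => exists m,
        admissible (d w) (x0 w) (A w) (cos z) n (q m w))). intros n.
      apply (sa_union HM (fun m w => admissible (d w) (x0 w) (A w) (cos z) n (q m w))). intros m.
      apply (Hadm (fun _ => z)). apply (borel_const HM).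
    - intros w. apply (circumradius_le_iff (Hm w) (Hc w) (Hp w) (fun m => q m w)); auto. lra. }
  split; auto.
  intros Hlt c Hcc. split; [intros w; apply Hcc|].
  (* The criterion of [circumcenter_le_iff] uses only countable quantifiers, and its admissibility
     condition is Borel because the circumradius is, by (i). *)
  intros x Hx. apply (borel_fun_of_le HM). intros z. eapply sa_ext.
  - apply (sa_forall HM (fun j w => exists n m, (j <= n)%nat /\
      admissible (d w) (x0 w) (A w) (cos (circumradius (d w) (x0 w) (A w))) n (q m w) /\
      iota (d w) (x0 w) (q m w) (x w) <= z + / INR (S j))). intros j.
    apply (sa_union HM (fun n w => exists m, (j <= n)%nat /\
      admissible (d w) (x0 w) (A w) (cos (circumradius (d w) (x0 w) (A w))) n (q m w) /\
      iota (d w) (x0 w) (q m w) (x w) <= z + / INR (S j))). intros n.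
    apply (sa_union HM (fun m w => (j <= n)%nat /\
      admissible (d w) (x0 w) (A w) (cos (circumradius (d w) (x0 w) (A w))) n (q m w) /\
      iota (d w) (x0 w) (q m w) (x w) <= z + / INR (S j))). intros m.
    apply (sa_and HM); [apply (sa_prop HM)|].
    apply (sa_and HM).
    + apply (Hadm (fun w => circumradius (d w) (x0 w) (A w))). auto.
    + apply (borel_le HM); [|apply (borel_const HM)].
      apply (borel_plus HM); [apply Hd; auto|apply (borel_opp HM), Hd; auto].
  - intros w. apply (circumcenter_le_iff (Hm w) (Hc w) (Hp w) (fun m => q m w)); auto.
Qed.
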